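(* Let $a,b$ be real numbers with $1<a<b$. Then $$\pi=\frac{2a\sqrt{b^2-a^2}\,\sqrt{a^2b^2-1}}{b^2(b^2-1)}\;\frac{(1-b^2+b^4)\,K\!\left(\dfrac{b(a^2-1)}{a(b^2-1)}\right)-(b^2-1)^2\,E\!\left(\dfrac{b(a^2-1)}{a(b^2-1)}\right)}{F_D^{(3)}\!\left(\tfrac12;-\tfrac32,\tfrac12,\tfrac12;1\,\Big|\,1-a^4,\dfrac{(a^4-1)b^2}{a^2-b^2},\dfrac{a^4-1}{a^2b^2-1}\right)}.$$
   Context: $K(k)=\int_0^1\frac{dx}{\sqrt{(1-x^2)(1-k^2x^2)}}$ and $E(k)=\int_0^1\sqrt{\frac{1-k^2x^2}{1-x^2}}\,dx$ are the complete elliptic integrals of the first and second kind, as functions of the modulus $k$. The Lauricella function of $n$ variables is $F_D^{(n)}(\alpha;\beta_1,\dots,\beta_n;\gamma\,|\,x_1,\dots,x_n)=\sum_{m_1,\dots,m_n\ge0}\frac{(\alpha)_{m_1+\cdots+m_n}(\beta_1)_{m_1}\cdots(\beta_n)_{m_n}}{(\gamma)_{m_1+\cdots+m_n}\,m_1!\cdots m_n!}x_1^{m_1}\cdots x_n^{m_n}$ for $|x_j|<1$, with $(x)_k$ the Pochhammer symbol. For $\operatorname{Re}\gamma>\operatorname{Re}\alpha>0$ it equals, and outside the region of convergence is defined by analytic continuation through, $\frac{\Gamma(\gamma)}{\Gamma(\alpha)\Gamma(\gamma-\alpha)}\int_0^1\frac{u^{\alpha-1}(1-u)^{\gamma-\alpha-1}}{(1-x_1u)^{\beta_1}\cdots(1-x_nu)^{\beta_n}}\,du$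 (principal branches, $x_j\notin[1,\infty)$). *)

(* Defs.v *)
From HB Require Import structures.
From mathcomp Require Import all_boot all_order all_algebra.
From mathcomp Require Import all_classical all_reals all_analysis.

Set Implicit Arguments.
Unset Strict Implicit.
Unset Printing Implicit Defensive.

Import Order.TTheory GRing.Theory Num.Theory.
Import numFieldNormedType.Exports.

Local Open Scope classical_set_scope.
Local Open Scope ring_scope.

(* In both elliptic integrals the integrand has the junk value of a division
   by zero at the endpoint x = 1, which is a null set. *)
Definition ellipticK (R : realType) (k : R) : R :=
  \int[@lebesgue_measure R]_(x in `[0, 1])
    (1 / Num.sqrt ((1 - x ^+ 2) * (1 - k ^+ 2 * x ^+ 2))).

Definition ellipticE (R : realType) (k : R) : R :=
  \int[@lebesgue_measure R]_(x in `[0, 1])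
    Num.sqrt ((1 - k ^+ 2 * x ^+ 2) / (1 - x ^+ 2)).

Definition pochhammer (R : realType) (x : R) (k : nat) : R :=
  \prod_(i < k) (x + i%:R).

(* Euler's integral; meaningful for 0 < s. *)
Definition Gamma (R : realType) (s : R) : R :=
  \int[@lebesgue_measure R]_(t in `]0, +oo[) (t `^ (s - 1) * expR (- t)).

Definition lauricella_term (R : realType) (n : nat) (alpha : R)
    (beta : n.-tuple R) (gamma : R) (x : n.-tuple R) (m : 'I_n -> nat) : R :=
  (pochhammer alpha (\sum_(j < n) m j)%N
     * \prod_(j < n) pochhammer (tnth beta j) (m j))
  / (pochhammer gamma (\sum_(j < n) m j)%N * \prod_(j < n) ((m j)`!)%:R)
  * \prod_(j < n) tnth x j ^+ m j.

(* The n-fold series, as the limit of the sums over the cubes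
   0 <= m_1, ..., m_n < N; it converges absolutely when all |x_j| < 1, so its
   sum does not depend on the order of summation. *)
Definition lauricella_series (R : realType) (n : nat) (alpha : R)
    (beta : n.-tuple R) (gamma : R) (x : n.-tuple R) : R :=
  limn (fun N : nat => \sum_(m : {ffun 'I_n -> 'I_N})
    lauricella_term alpha beta gamma x (fun j => nat_of_ord (m j))).

(* Meaningful for 0 < alpha < gamma and all x_j < 1: the bases 1 - x_j u are
   then positive and the real powers are the principal branches. *)
Definition lauricella_integral (R : realType) (n : nat) (alpha : R)
    (beta : n.-tuple R) (gamma : R) (x : n.-tuple R) : R :=
  Gamma gamma / (Gamma alpha * Gamma (gamma - alpha)) *
  \int[@lebesgue_measure R]_(u in `[0, 1])
    (u `^ (alpha - 1) * (1 - u) `^ (gamma - alpha - 1)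
     / \prod_(j < n) (1 - tnth x j * u) `^ (tnth beta j)).

(* Lauricella's F_D^(n) for real parameters and arguments: the series on its
   region of convergence, and outside of it the continuation given by the
   Euler-type integral. *)
Definition lauricellaFD (R : realType) (n : nat) (alpha : R)
    (beta : n.-tuple R) (gamma : R) (x : n.-tuple R) : R :=
  if [forall j : 'I_n, `|tnth x j| < 1]
  then lauricella_series alpha beta gamma x
  else lauricella_integral alpha beta gamma x.

(* Main.v *)
Require Import Defs.
From HB Require Import structures.
From mathcomp Require Import all_boot all_order all_algebra.
From mathcomp Require Import all_classical all_reals all_analysis.
From mathcomp Require Import measurable_realfun.
From mathcomp Require Import ring lra.
Import Order.TTheory GRing.Theory Num.Theory.
Import numFieldNormedType.Exports.
Local Open Scope classical_set_scope.
Local Open Scope ring_scope.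

(** The Lauricella value is an Euler integral, and that integral is a
    hyperelliptic one of genus 2 which folds into two elliptic integrals.

    For alpha = 1/2 and gamma = 1 the Euler integrand is the arcsine weight
    [1 / sqrt (u (1 - u))] times the kernel [\prod_j (1 - x_j u)^(- beta_j)],
    and the constant in front is [1 / pi]; this gives [lauricellaFD_half_one].
    Depending on [a] and [b] the three arguments may or may not all lie in the
    open unit disc, so both branches of the definition have to be reached.  On
    the series branch the binomial series of the factors
    ([cvg_binomial_series]) are multiplied out and integrated term by term
    against the weight, whose moments are Wallis integrals
    ([arcsine_moment]); dominated convergence justifies the passage to the
    limit.  On the integral branch one needs the values of Gamma at 1 and 1/2.

    In the case at hand put [w = 1 + (a^4 - 1) u], which runs from 1 to [a^4].
    Up to a constant the integral becomes that of
    [w^(3/2) / sqrt ((w - 1) (a^4 - w) (b^2 w - a^2) (a^2 b^2 - w))], and the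
    polynomial under the root is respected by the involution [w -> a^4 / w].
    With [w = a^2 p^2] the involution is [p -> 1 / p], so the two halves of
    the interval, cut at its fixed point [p = 1], can both be written over
    [1 < p < a] with the same square root and the numerators [p^4] and
    [p^-2] ([integral_right], [integral_left]).  Their sum is
    [p^4 + p^-2 = (p^2 + 1) (1 + (p - 1/p)^2)], in which [(p^2 + 1) dp] is
    [p^2] times the differential of [p - 1/p].  Hence [x] proportional to
    [p - 1/p], normalized to run from 0 to 1, turns the sum into
    [(1 + (a - 1/a)^2 x^2) / sqrt ((1 - x^2) (1 - k^2 x^2))]
    ([integral_h]), which is a combination of the integrands of [K] and [E]
    ([elliptic_combination]).

    The integrands are nonnegative but may blow up at the ends of the
    intervals; [ge0_substitution] therefore states the change of variables on open
    sets, by exhaustion with segments.  The quotient in the theorem is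
    meaningful because the elliptic combination is positive
    ([elliptic_numerator_gt0]). *)

(** * Change of variables for integrands singular at the boundary *)

(** Equality on each member of two increasing sequences of sets passes to the
    unions, both sides being monotone limits. *)
Lemma ge0_integral_exhaustion {R : realType} (U V : (set R)^nat) (g h : R -> R) :
  (forall n, measurable (U n)) -> (forall n, measurable (V n)) ->
  nondecreasing_seq U -> nondecreasing_seq V ->
  (forall n, measurable_fun (U n) g) -> (forall n, measurable_fun (V n) h) ->
  (forall n x, U n x -> 0 <= g x) -> (forall n x, V n x -> 0 <= h x) ->
  (forall n, (\int[lebesgue_measure]_(x in U n) (g x)%:E =
              \int[lebesgue_measure]_(x in V n) (h x)%:E)%E) ->
  (\int[lebesgue_measure]_(x in \bigcup_n U n) (g x)%:E =
   \int[lebesgue_measure]_(x in \bigcup_n V n) (h x)%:E)%E.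
Proof.
move=> mU mV ndU ndV mg mh g0 h0 gh.
have cvg_int (W : (set R)^nat) (f : R -> R) :
    (forall n, measurable (W n)) -> nondecreasing_seq W ->
    (forall n, measurable_fun (W n) f) -> (forall n x, W n x -> 0 <= f x) ->
    (\int[lebesgue_measure]_(x in W n) (f x)%:E)%E @[n --> \oo] -->
    (\int[lebesgue_measure]_(x in \bigcup_n W n) (f x)%:E)%E.
  move=> mW ndW mf f0; apply: ge0_nondecreasing_set_cvg_integral => //.
  by move=> n; apply/measurable_EFinP; exact: mf.
have cg := cvg_int U g mU ndU mg g0.
have ch := cvg_int V h mV ndV mh h0.
have E : (fun n => \int[lebesgue_measure]_(x in U n) (g x)%:E)%E =
  (fun n => \int[lebesgue_measure]_(x in V n) (h x)%:E)%E by exact/funext.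
rewrite E in cg; exact: cvg_unique cg ch.
Qed.

Lemma continuous_in_measurable {R : realType} (A : set R) (f : R -> R) :
  measurable A -> {in A, continuous f} -> measurable_fun A f.
Proof.
move=> mA cf; apply: subspace_continuous_measurable_fun => //.
exact: continuous_in_subspaceT.
Qed.


Lemma image_segment_increasing {R : realType} (F : R -> R) (c d : R) : c <= d ->
  {within `[c, d], continuous F} -> {in `[c, d] &, {homo F : x y / x < y}} ->
  F @` `[c, d] = `[F c, F d]%classic.
Proof.
move=> cd cF incF.
have ndF x y : x \in `[c, d] -> y \in `[c, d] -> x <= y -> F x <= F y.
  move=> xcd ycd; rewrite le_eqVlt => /predU1P[->//|xy].
  by rewrite ltW// incF.
have ccd : c \in `[c, d] by rewrite in_itv/= lexx cd.
have dcd : d \in `[c, d] by rewrite in_itv/= lexx cd.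
apply/seteqP; split => [_ [x /= xcd <-]|y /= ycd].
  by move: (xcd); rewrite !in_itv/= => /andP[cx xd]; rewrite !ndF.
have [|x xcd <-] := @IVT _ F c d y cd cF; last by exists x.
by rewrite minEle maxEle ndF//; move: ycd; rewrite in_itv.
Qed.

Lemma image_segment_decreasing {R : realType} (F : R -> R) (c d : R) : c <= d ->
  {within `[c, d], continuous F} -> {in `[c, d] &, {homo F : x y /~ x < y}} ->
  F @` `[c, d] = `[F d, F c]%classic.
Proof.
move=> cd cF decF.
have niF x y : x \in `[c, d] -> y \in `[c, d] -> x <= y -> F y <= F x.
  move=> xcd ycd; rewrite le_eqVlt => /predU1P[->//|xy].
  by rewrite ltW// decF.
have ccd : c \in `[c, d] by rewrite in_itv/= lexx cd.
have dcd : d \in `[c, d] by rewrite in_itv/= lexx cd.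
apply/seteqP; split => [_ [x /= xcd <-]|y /= ycd].
  by move: (xcd); rewrite !in_itv/= => /andP[cx xd]; rewrite !niF.
have [|x xcd <-] := @IVT _ F c d y cd cF; last by exists x.
by rewrite minC maxC minEle maxEle niF//; move: ycd; rewrite in_itv.
Qed.

(** The two orientations are treated at once: the derivative enters through its
    absolute value and the domain of integration is the image, so that a decreasing
    change of variables needs no exchange of bounds. *)
Section substitution.
Context {R : realType} (A : set R) (F f G : R -> R).
Hypothesis oA : open A.
Hypothesis dF : forall x : R, x \in A -> is_derive x (1 : R) F (f x).
Hypothesis cf : {in A, continuous f}.
Hypothesis f0 : {in A, forall x, 0 < f x} \/ {in A, forall x, f x < 0}.
Hypothesis cG : {in F @` A, continuous G}.

Let derive1F x : x \in A -> (F^`()%classic) x = f x.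
Proof. by move=> xA; rewrite derive1E; have [] := dF x xA. Qed.

Let continuousF x : x \in A -> {for x, continuous F}.
Proof.
move=> xA; apply/differentiable_continuous; rewrite -derivable1_diffP.
by have [] := dF x xA.
Qed.

Let continuous_derive1F x : x \in A -> {for x, continuous (F^`()%classic)}.
Proof.
move=> xA; rewrite /prop_for /continuous_at derive1F//.
apply: cvg_trans (cf x xA); apply: near_eq_cvg.
have : \forall y \near x, A y by apply: open_nbhs_nbhs; split => //; exact/set_mem.
by apply: filterS => y Ay; rewrite derive1F//; exact/mem_set.
Qed.

Lemma substitution_segment (c d : R) : c < d -> `[c, d] `<=` A ->
  measurable (F @` `[c, d]) /\
  (\int[lebesgue_measure]_(y in F @` `[c, d]) (G y)%:E =
   \int[lebesgue_measure]_(x in `[c, d]) (G (F x) * `|f x|)%:E)%E.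
Proof.
move=> cd cdA.
have inA x : x \in `[c, d] -> x \in A by move=> xcd; apply/mem_set/cdA.
have oo x : x \in `]c, d[ -> x \in A.
  by move=> xcd; apply: inA; apply: subset_itv_oo_cc xcd.
have cA : c \in A by apply: inA; rewrite in_itv/= lexx ltW.
have dA : d \in A by apply: inA; rewrite in_itv/= lexx ltW.
have cFcd : {within `[c, d], continuous F}.
  by apply: continuous_in_subspaceT => x; rewrite inE => /inA; exact: continuousF.
have dFoo x : x \in `]c, d[ -> derivable F x 1 by move=> /oo xA; have [] := dF x xA.
have cF'oo : {in `]c, d[, continuous (F^`()%classic)}.
  by move=> x /oo; exact: continuous_derive1F.
have F'c : cvg ((F^`()%classic) x @[x --> c^'+]).
  apply/cvg_ex; exists ((F^`()%classic) c); apply: cvg_at_right_filter.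
  exact: continuous_derive1F.
have F'd : cvg ((F^`()%classic) x @[x --> d^'-]).
  apply/cvg_ex; exists ((F^`()%classic) d); apply: cvg_at_left_filter.
  exact: continuous_derive1F.
have FLR : derivable_oo_LRcontinuous F c d.
  split; first exact: dFoo.
  + by apply: cvg_at_right_filter; exact: continuousF.
  + by apply: cvg_at_left_filter; exact: continuousF.
have cGF (B : set R) : B = F @` `[c, d] -> {within B, continuous G}.
  move=> ->; apply: continuous_in_subspaceT => y; rewrite inE => -[x xcd <-].
  by apply: cG; rewrite inE; exists x => //; exact: cdA.
case: f0 => [fpos|fneg].
  have incF : {in `[c, d] &, {homo F : x y / x < y}}.
    apply: (gtr0_derive1_lt_cc dFoo _ cFcd) => x /oo xA.
    by rewrite (derive1F _ xA); exact: fpos.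
  have E := image_segment_increasing F c d (ltW cd) cFcd incF.
  rewrite E; split; first exact: measurable_itv.
  rewrite integration_by_substitution_increasing ?(ltW cd)//; last exact: cGF.
  apply: eq_integral => x; rewrite inE => /inA xA.
  by rewrite fctE/= derive1F// gtr0_norm// fpos.
have decF : {in `[c, d] &, {homo F : x y /~ x < y}}.
  apply: (ltr0_derive1_lt_cc dFoo _ cFcd) => x /oo xA.
  by rewrite (derive1F _ xA); exact: fneg.
have E := image_segment_decreasing F c d (ltW cd) cFcd decF.
rewrite E; split; first exact: measurable_itv.
rewrite (@integration_by_substitution_decreasing _ F _ c d)// ?(ltW cd)//; last exact: cGF.
apply: eq_integral => x; rewrite inE => /inA xA.
by rewrite !fctE/= derive1F// ltr0_norm// fneg.
Qed.

(** Nothing is assumed at the boundary of [A], where [G] and [f] may be unbounded: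
    the formula holds on each segment of an exhaustion and both sides converge
    monotonically. *)
Lemma ge0_substitution (c d : R^nat) :
  (forall n, c n < d n) -> nonincreasing_seq c -> nondecreasing_seq d ->
  A = \bigcup_n `[c n, d n]%classic ->
  {in A, forall x, 0 <= G (F x)} ->
  (\int[lebesgue_measure]_(y in F @` A) (G y)%:E =
   \int[lebesgue_measure]_(x in A) (G (F x) * `|f x|)%:E)%E.
Proof.
move=> cd nic ndd AE G0.
have cdA n : `[c n, d n] `<=` A by rewrite AE => x xcd; exists n.
have inA n x : (`[c n, d n]%classic) x -> x \in A by move=> /cdA; rewrite inE.
have nd : nondecreasing_seq (fun n => `[c n, d n]%classic).
  move=> m n mn; rewrite subsetEset; apply: subset_itv; rewrite bnd_simp.
    exact: nic.
  exact: ndd.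
have -> : F @` A = \bigcup_n (F @` `[c n, d n]).
  by rewrite {1}AE image_bigcup.
rewrite [in RHS]AE.
apply: ge0_integral_exhaustion.
- by move=> n; have [] := substitution_segment _ _ (cd n) (cdA n).
- by move=> n; exact: measurable_itv.
- move=> m n mn; rewrite subsetEset; apply: image_subset.
  by rewrite -subsetEset; exact: nd.
- exact: nd.
- move=> n; apply: continuous_in_measurable.
    by have [] := substitution_segment _ _ (cd n) (cdA n).
  move=> y; rewrite inE => -[x xcd <-]; apply: cG; rewrite inE.
  by exists x => //; exact: cdA xcd.
- move=> n; apply: continuous_in_measurable; first exact: measurable_itv.
  move=> x; rewrite inE => /inA xA.
  apply: cvgM; last by apply: cvg_norm; exact: cf.
  apply: continuous_comp; first exact: continuousF.
  by apply: cG; rewrite inE; exists x => //; exact/set_mem.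
- by move=> n y [x /inA xA <-]; exact: G0.
- by move=> n x /inA xA; rewrite mulr_ge0// G0.
- by move=> n; have [] := substitution_segment _ _ (cd n) (cdA n).
Qed.

End substitution.

Lemma image_oo_increasing {R : realType} (F : R -> R) (l r : R) : l < r ->
  {within `[l, r], continuous F} -> {in `[l, r] &, {homo F : x y / x < y}} ->
  F @` `]l, r[ = `]F l, F r[%classic.
Proof.
move=> lr cF incF.
have llr : l \in `[l, r] by rewrite in_itv/= lexx ltW.
have rlr : r \in `[l, r] by rewrite in_itv/= lexx ltW.
apply/seteqP; split => [_ [x /= xlr <-]|y /= /[dup] ylr].
  have xlr' := subset_itv_oo_cc xlr.
  by move: xlr; rewrite !in_itv/= => /andP[lx xr]; rewrite !incF.
move=> /subset_itv_oo_cc ylr'.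
have : (`[F l, F r]%classic) y by [].
rewrite -(image_segment_increasing F l r (ltW lr))// => -[x /= xlr Fxy].
exists x => //=; move: ylr xlr; rewrite -Fxy !in_itv/= => /andP[lx xr] /andP[].
rewrite le_eqVlt => /predU1P[xE|->]; first by rewrite xE ltxx in lx.
by rewrite le_eqVlt => /predU1P[xE|//]; rewrite xE ltxx in xr.
Qed.

Lemma image_oo_decreasing {R : realType} (F : R -> R) (l r : R) : l < r ->
  {within `[l, r], continuous F} -> {in `[l, r] &, {homo F : x y /~ x < y}} ->
  F @` `]l, r[ = `]F r, F l[%classic.
Proof.
move=> lr cF decF.
have llr : l \in `[l, r] by rewrite in_itv/= lexx ltW.
have rlr : r \in `[l, r] by rewrite in_itv/= lexx ltW.
apply/seteqP; split => [_ [x /= xlr <-]|y /= /[dup] ylr].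
  have xlr' := subset_itv_oo_cc xlr.
  by move: xlr; rewrite !in_itv/= => /andP[lx xr]; rewrite !decF.
move=> /subset_itv_oo_cc ylr'.
have : (`[F r, F l]%classic) y by [].
rewrite -(image_segment_decreasing F l r (ltW lr))// => -[x /= xlr Fxy].
exists x => //=; move: ylr xlr; rewrite -Fxy !in_itv/= => /andP[rx xl] /andP[].
rewrite le_eqVlt => /predU1P[xE|->]; first by rewrite xE ltxx in xl.
by rewrite le_eqVlt => /predU1P[xE|//]; rewrite xE ltxx in rx.
Qed.

(** The step is divided by [n + 3], so that the two ends never meet, not even for
    [n = 0]. *)
Lemma itv_oo_exhaustion {R : realType} (l r : R) : l < r ->
  let e n := (r - l) / n.+3%:R in
  [/\ forall n, l + e n < r - e n,
      {homo (fun n => l + e n) : m n / (m <= n)%N >-> n <= m},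
      {homo (fun n => r - e n) : m n / (m <= n)%N >-> m <= n} &
      `]l, r[%classic = \bigcup_n `[l + e n, r - e n]%classic].
Proof.
move=> lr e; have lr0 : 0 < r - l by rewrite subr_gt0.
have e0 n : 0 < e n by rewrite divr_gt0.
have nie m n : (m <= n)%N -> e n <= e m.
  by move=> mn; rewrite ler_pM2l// lef_pV2 ?posrE// ler_nat.
have eE n : e n * n.+3%:R = r - l by rewrite divfK// pnatr_eq0.
split => [n|m n mn|m n mn|].
- have : e n * 2 < e n * n.+3%:R by rewrite ltr_pM2l// ltr_nat.
  rewrite eE; lra.
- by rewrite lerD2l nie.
- by rewrite lerD2l lerN2 nie.
apply/seteqP; split => x /=; last first.
  by move=> [n _ /=]; rewrite !in_itv/= => /andP[? ?]; have := e0 n; lra.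
rewrite in_itv/= => /andP[lx xr].
pose m := Num.min (x - l) (r - x).
have m0 : 0 < m by rewrite lt_min !subr_gt0 lx.
have [n nP] : exists n : nat, (r - l) / m < n%:R.
  by exists (Num.truncn ((r - l) / m)).+1; rewrite truncnS_gt.
have : e n < m.
  rewrite ltr_pdivrMr// mulrC -ltr_pdivrMr//; apply: lt_le_trans nP _.
  by rewrite ler_nat -addn3 leq_addr.
rewrite lt_min => /andP[? ?].
by exists n => //=; rewrite in_itv/=; apply/andP; split; lra.
Qed.

Section substitution_oo.
Context {R : realType} (F f G : R -> R) (l r : R).
Hypothesis lr : l < r.
Hypothesis dF : forall x : R, x \in `]l, r[ -> is_derive x (1 : R) F (f x).
Hypothesis cf : {in `]l, r[, continuous f}.
Hypothesis cFl : {for l, continuous F}.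
Hypothesis cFr : {for r, continuous F}.

Let cF : {within `[l, r], continuous F}.
Proof.
apply/continuous_within_itvP => //; split.
- move=> x xlr; apply/differentiable_continuous; rewrite -derivable1_diffP.
  by have [] := dF x xlr.
- exact: cvg_at_right_filter.
- exact: cvg_at_left_filter.
Qed.

Let derivableF x : x \in `]l, r[ -> derivable F x 1.
Proof. by move=> xlr; have [] := dF x xlr. Qed.

Let derive1F x : x \in `]l, r[ -> (F^`()%classic) x = f x.
Proof. by move=> xlr; rewrite derive1E; have [] := dF x xlr. Qed.

Lemma ge0_substitution_increasing : {in `]l, r[, forall x, 0 < f x} ->
  {in `]F l, F r[, continuous G} -> {in `]F l, F r[, forall x, 0 <= G x} ->
  (\int[lebesgue_measure]_(y in `]F l, F r[) (G y)%:E =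
   \int[lebesgue_measure]_(x in `]l, r[) (G (F x) * f x)%:E)%E.
Proof.
move=> f0 cG G0.
have incF : {in `[l, r] &, {homo F : x y / x < y}}.
  by apply: gtr0_derive1_lt_cc => // x xlr; rewrite derive1F// f0.
have FE := image_oo_increasing F l r lr cF incF.
have [cd nic ndd E] := itv_oo_exhaustion l r lr.
rewrite -FE (@ge0_substitution _ _ F f G _ _ _ _ _ _ _ cd)//.
- apply: eq_integral => x; rewrite inE => xlr.
  by rewrite gtr0_norm// f0.
- by move=> x; rewrite inE; exact: dF.
- by move=> x; rewrite inE; exact: cf.
- by left => x; rewrite inE; exact: f0.
- by rewrite FE => y; rewrite inE; exact: cG.
- move=> x; rewrite inE => xlr; apply: G0.
  have : (F @` `]l, r[) (F x) by exists x.
  by rewrite FE.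
Qed.

Lemma ge0_substitution_decreasing : {in `]l, r[, forall x, f x < 0} ->
  {in `]F r, F l[, continuous G} -> {in `]F r, F l[, forall x, 0 <= G x} ->
  (\int[lebesgue_measure]_(y in `]F r, F l[) (G y)%:E =
   \int[lebesgue_measure]_(x in `]l, r[) (G (F x) * - f x)%:E)%E.
Proof.
move=> f0 cG G0.
have decF : {in `[l, r] &, {homo F : x y /~ x < y}}.
  by apply: ltr0_derive1_lt_cc => // x xlr; rewrite derive1F// f0.
have FE := image_oo_decreasing F l r lr cF decF.
have [cd nic ndd E] := itv_oo_exhaustion l r lr.
rewrite -FE (@ge0_substitution _ _ F f G _ _ _ _ _ _ _ cd)//.
- apply: eq_integral => x; rewrite inE => xlr.
  by rewrite ltr0_norm// f0.
- by move=> x; rewrite inE; exact: dF.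
- by move=> x; rewrite inE; exact: cf.
- by right => x; rewrite inE; exact: f0.
- by rewrite FE => y; rewrite inE; exact: cG.
- move=> x; rewrite inE => xlr; apply: G0.
  have : (F @` `]l, r[) (F x) by exists x.
  by rewrite FE.
Qed.

End substitution_oo.

(** * Gamma at 1 and 1/2 *)

Lemma continuous_powR_gt0 {R : realType} (p x : R) : 0 < x ->
  {for x, continuous (fun y : R => y `^ p)}.
Proof.
move=> x0; have : derivable (fun y : R => y `^ p) x 1.
  by apply: derivable_powR; rewrite in_itv/= x0.
by move=> /derivable1_diffP /differentiable_continuous.
Qed.

Lemma Gamma1 {R : realType} : Gamma (1 : R) = 1.
Proof.
have := @integral_exponential_pdf R 1 ltr01.
rewrite /Gamma /Rintegral.
have -> : (\int[lebesgue_measure]_x (exponential_pdf (1 : R) x)%:E =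
    \int[lebesgue_measure]_(x in `[(0 : R)%R, +oo[) (expR (- x)%R)%:E)%E.
  rewrite [in RHS]integral_mkcond; apply: eq_integral => x _.
  by rewrite /exponential_pdf /patch; case: ifP => // _; rewrite mul1r mulN1r.
rewrite -integral_itv_obnd_cbnd; last first.
  apply/measurable_EFinP; apply: continuous_in_measurable => // x _.
  by apply: continuous_comp; [exact: opp_continuous|exact: continuous_expR].
move=> E1; rewrite -[RHS]/(fine 1%:E) -E1; congr fine.
by apply: eq_integral => x _; rewrite subrr powRr0 mul1r.
Qed.

Lemma itv_0y_exhaustion {R : realType} :
  (`]0, +oo[%classic : set R) = \bigcup_n `[n.+2%:R^-1, n.+2%:R]%classic.
Proof.
apply/seteqP; split => x /=; last first.
  by move=> [n _ /=]; rewrite !in_itv/= andbT => /andP[+ _]; apply: lt_le_trans.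
rewrite in_itv/= andbT => x0.
have [n nP] : exists n : nat, Num.max x x^-1 < n%:R.
  by exists (Num.truncn (Num.max x x^-1)).+1; rewrite truncnS_gt.
exists n => //=; rewrite in_itv/=.
move: nP; rewrite gt_max => /andP[xn xVn].
have nn2 : (n%:R : R) <= n.+2%:R by rewrite ler_nat -addn2 leq_addr.
rewrite (le_trans (ltW xn))// andbT invf_ple ?posrE//.
exact: le_trans (ltW xVn) nn2.
Qed.

(** The substitution [t = s^2] turns Euler's integral into the Gaussian integral. *)
Lemma Gamma_half {R : realType} : Gamma (1 / 2 : R) = Num.sqrt pi.
Proof.
pose A : set R := `]0, +oo[%classic.
have A0 (x : R) : x \in A -> 0 < x by move=> /set_mem; rewrite /A/= in_itv/= andbT.
have FE : (fun s : R => s ^+ 2) @` A = A.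
  apply/seteqP; split => [_ [x /mem_set/A0 x0 <-]|x /mem_set/A0 x0].
    by rewrite /A/= in_itv/= andbT exprn_gt0.
  exists (Num.sqrt x); last by rewrite sqr_sqrtr// ltW.
  by rewrite /A/= in_itv/= andbT sqrtr_gt0.
rewrite /Gamma /Rintegral -[X in integral _ X]FE.
rewrite (@ge0_substitution _ A (fun s => s ^+ 2) (fun s => 2 * s) _ _ _ _ _ _
  (fun n => n.+2%:R^-1) (fun n => n.+2%:R)).
- rewrite (_ : integral _ _ _ = 2%:E * (\int[lebesgue_measure]_(x in A) (gauss_fun x)%:E))%E.
    rewrite integral_itv_obnd_cbnd; last first.
      apply/measurable_EFinP; apply: measurable_funTS; exact: measurable_gauss_fun.
    by rewrite integral0y_gauss -EFinM/= mulrC divfK.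
  rewrite -ge0_integralZl//=; last 3 first.
  + exact: measurable_itv.
  + apply/measurable_EFinP; apply: measurable_funTS; exact: measurable_gauss_fun.
  + by move=> x _; rewrite lee_fin gauss_fun_ge0.
  apply: eq_integral => x xA; rewrite -EFinM; congr EFin.
  have x0 := A0 _ xA.
  rewrite (_ : 1 / 2 - 1 = - 2^-1); last by field.
  rewrite powRN powR12_sqrt ?sqr_ge0// sqrtr_sqr gtr0_norm//.
  rewrite gtr0_norm ?mulr_gt0// /gauss_fun.
  by field; rewrite gt_eqF.
- exact: interval_open.
- by move=> x _; apply: is_derive_eq; rewrite /GRing.scale/= mulr1 mulrDl mul1r.
- by move=> x _; apply: cvgM; [exact: cvg_cst|exact: cvg_id].
- by left => x /A0 x0; rewrite mulr_gt0.
- rewrite FE => x /A0 x0; apply: cvgM; last first.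
    by apply: continuous_comp; [exact: opp_continuous|exact: continuous_expR].
  exact: continuous_powR_gt0.
- by move=> n; rewrite (@lt_trans _ _ 1)// ?invf_lt1// ltr1n.
- by move=> m n mn; rewrite lef_pV2 ?posrE// ler_nat.
- by move=> m n mn; rewrite ler_nat.
- exact: itv_0y_exhaustion.
- by move=> x /A0 x0; rewrite mulr_ge0 ?powR_ge0// expR_ge0.
Qed.

(** * Moments of the arcsine weight *)

(** The exponents are kept in the form that they have in Euler's integral for
    alpha = 1/2 and gamma = 1. *)
Definition arcsine_weight {R : realType} (u : R) : R :=
  u `^ (1 / 2 - 1) * (1 - u) `^ (1 - 1 / 2 - 1).

Lemma arcsine_weight_ge0 {R : realType} (u : R) : 0 <= arcsine_weight u.
Proof. by rewrite mulr_ge0 ?powR_ge0. Qed.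

Lemma arcsine_weightE {R : realType} (u : R) : 0 < u < 1 ->
  arcsine_weight u = (Num.sqrt (u * (1 - u)))^-1.
Proof.
move=> /andP[u0 u1]; have u1' : 0 < 1 - u by rewrite subr_gt0.
have e1 : 1 / 2 - 1 = - 2^-1 :> R by field.
have e2 : 1 - 1 / 2 - 1 = - 2^-1 :> R by field.
rewrite /arcsine_weight e1 e2.
by rewrite !powRN !powR12_sqrt ?ltW// sqrtrM ?ltW// invfM.
Qed.

Lemma measurable_arcsine_weight {R : realType} (A : set R) :
  measurable_fun A (@arcsine_weight R).
Proof.
apply: measurable_funTS; apply: measurable_funM; first exact: measurable_powR.
apply: (@measurableT_comp _ _ _ _ _ _ (fun x : R => x `^ _)).
  exact: measurable_powR.
exact: measurable_funB.
Qed.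

Lemma pochhammerS {R : realType} (x : R) n :
  pochhammer x n.+1 = pochhammer x n * (x + n%:R).
Proof. by rewrite /pochhammer big_ord_recr. Qed.

Lemma pochhammer_gt0 {R : realType} (x : R) n : 0 < x -> 0 < pochhammer x n.
Proof. by move=> x0; apply: prodr_gt0 => i _; rewrite ltr_wpDr. Qed.

(** Integrate the derivative of [- sin^(2m+1) cos], which vanishes at both ends. *)
Lemma wallis_recurrence {R : realType} (m : nat) :
  m.+1%:R * \int[lebesgue_measure]_(t in `[0, pi / 2]) (sin t ^+ (2 * m.+1)) =
  (m%:R + 1 / 2) * \int[lebesgue_measure]_(t in `[0, pi / 2]) (sin t ^+ (2 * m)) :> R.
Proof.
have csin k : continuous (fun t : R => sin t ^+ k).
  move=> t; apply: (@continuous_comp _ _ _ sin (fun x : R => x ^+ k)).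
    exact: continuous_sin.
  exact: exprn_continuous.
have int_sin k : (@lebesgue_measure R).-integrable `[0, pi / 2]
    (EFin \o (fun t => sin t ^+ k)).
  apply: continuous_compact_integrable; first exact: segment_compact.
  by apply: continuous_subspaceT; exact: csin.
have pi2 : (0 : R) < pi / 2 by rewrite divr_gt0 ?pi_gt0.
pose F : R -> R := - (@sin R ^+ (2 * m).+1 * @cos R).
pose f (t : R) := (2 * m).+2%:R * sin t ^+ (2 * m.+1) - (2 * m).+1%:R * sin t ^+ (2 * m).
have dF (t : R) : is_derive t (1 : R) F (f t).
  rewrite /F; apply: is_derive_eq.
  rewrite /GRing.scale/= !fctE /f mulnS add2n !exprS.
  rewrite -[(2 * m).+2%:R]natr1; have := cos2Dsin2 t.
  move: (sin t) (cos t) (_ ^+ (2 * m)) (_.+1%:R) => s c e k cs.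
  apply/eqP; rewrite -subr_eq0.
  rewrite (_ : _ - _ = k * e * (1 - (c ^+ 2 + s ^+ 2))); last by ring.
  by rewrite cs subrr mulr0.
have cF : continuous F.
  by move=> t; apply/differentiable_continuous; rewrite -derivable1_diffP; have [] := dF t.
have FTC : (\int[lebesgue_measure]_(t in `[0%R, (pi / 2)%R]) (f t)%:E = 0)%E.
  rewrite (@continuous_FTC2 _ f F _ _ pi2).
  - by rewrite /F !fctE cos_pihalf sin0 expr0n/= mulr0 mul0r oppr0 subee.
  - apply: continuous_subspaceT => t; apply: cvgB; apply: cvgM; try exact: cvg_cst; exact: csin.
  - split.
    + by move=> t _; have [] := dF t.
    + by apply: cvg_at_right_filter; exact: cF.
    + by apply: cvg_at_left_filter; exact: cF.
  - by move=> t _; rewrite derive1E; have [] := dF t.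
have : \int[lebesgue_measure]_(t in `[0, pi / 2]) f t = 0 by rewrite /Rintegral FTC.
have intZ r k : (@lebesgue_measure R).-integrable `[0, pi / 2]
    (EFin \o (fun t => r * sin t ^+ k)).
  apply: continuous_compact_integrable; first exact: segment_compact.
  by apply: continuous_subspaceT => t; apply: cvgM; [exact: cvg_cst|exact: csin].
rewrite /f RintegralB// !RintegralZl//.
move=> /eqP; rewrite subr_eq0 => /eqP H.
have n2 : (2 : R) != 0 by rewrite pnatr_eq0.
have nE : (2 * m).+2%:R = 2 * m.+1%:R :> R by rewrite -[RHS]natrM mulnS.
apply: (mulfI n2); rewrite !mulrA -nE H; congr (_ * _).
by rewrite -[(2 * m).+1]addn1 natrD natrM; field.
Qed.

Lemma wallis_integral {R : realType} (m : nat) :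
  \int[lebesgue_measure]_(t in `[0, pi / 2]) (sin t ^+ (2 * m)) =
  pi / 2 * (pochhammer (1 / 2) m / pochhammer 1 m) :> R.
Proof.
elim: m => [|m IH].
  rewrite /pochhammer !big_ord0 divr1 mulr1.
  under eq_Rintegral do rewrite muln0 expr0.
  rewrite Rintegral_cst//= mul1r lebesgue_measure_itv/= lte_fin.
  by rewrite divr_gt0 ?pi_gt0//= subr0.
have p0 : pochhammer (1 : R) m != 0 by rewrite gt_eqF ?pochhammer_gt0.
have m0 : (m.+1%:R : R) != 0 by rewrite pnatr_eq0.
apply: (mulfI m0); rewrite wallis_recurrence IH !pochhammerS.
rewrite -[m.+1%:R in RHS]natr1 in m0 *; field.
by rewrite p0 addrC natr1 m0.
Qed.

Lemma continuous_arcsine_weight {R : realType} (u : R) : 0 < u < 1 ->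
  {for u, continuous (@arcsine_weight R)}.
Proof.
move=> /andP[u0 u1]; apply: cvgM; first exact: continuous_powR_gt0.
apply: (@continuous_comp _ _ _ (fun x : R => 1 - x) (fun y : R => y `^ _)).
  by apply: cvgB; [exact: cvg_cst|exact: cvg_id].
by apply: continuous_powR_gt0; rewrite subr_gt0.
Qed.

(** With [u = sin^2 t] the weight is absorbed by the differential and the moment
    becomes twice a Wallis integral. *)
Lemma arcsine_moment {R : realType} (m : nat) :
  (\int[lebesgue_measure]_(u in `[0%R, 1%R]) (arcsine_weight u * u ^+ m)%:E =
   (pi * (pochhammer (1 / 2) m / pochhammer 1 m))%:E :> \bar R)%E.
Proof.
have pi2 : (0 : R) < pi / 2 by rewrite divr_gt0 ?pi_gt0.
have sin0pi2 (t : R) : t \in `]0, (pi / 2)[ -> 0 < sin t.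
  by rewrite in_itv/= => tpi; apply: sin_gt0_pihalf.
have cos0pi2 (t : R) : t \in `]0, (pi / 2)[ -> 0 < cos t.
  rewrite in_itv/= => /andP[t0 tpi]; apply: cos_gt0_pihalf.
  by rewrite tpi andbT (lt_trans _ t0)// oppr_lt0.
rewrite integral_itv_bndoo; last first.
  apply/measurable_EFinP; apply: measurable_funM; first exact: measurable_arcsine_weight.
  exact: measurable_funX.
have := @ge0_substitution_increasing R (fun t => sin t ^+ 2) (fun t => 2 * sin t * cos t)
  (fun u => arcsine_weight u * u ^+ m) 0 (pi / 2) pi2.
rewrite sin0 sin_pihalf expr0n expr1n/= => subst.
rewrite (subst _ _ _ _ _ _ _).
- rewrite (_ : integral _ _ _ = \int[lebesgue_measure]_(t in `]0%R, (pi / 2)%R[)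
    (2 * sin t ^+ (2 * m))%:E)%E; last first.
    apply: eq_integral => t; rewrite inE/= => tpi.
    have s0 := sin0pi2 _ tpi; have c0 := cos0pi2 _ tpi.
    congr EFin.
    rewrite arcsine_weightE; last first.
      rewrite exprn_gt0//= -subr_gt0 -cos2sin2 exprn_gt0//.
    rewrite -cos2sin2 -exprMn sqrtr_sqr gtr0_norm ?mulr_gt0// -exprM.
    by field; rewrite !gt_eqF.
  have int_sin : (@lebesgue_measure R).-integrable `[0, pi / 2]
      (EFin \o (fun t => sin t ^+ (2 * m))).
    apply: continuous_compact_integrable; first exact: segment_compact.
    apply: continuous_subspaceT => t.
    apply: (@continuous_comp _ _ _ sin (fun x : R => x ^+ (2 * m))).
      exact: continuous_sin.
    exact: exprn_continuous.
  rewrite -(@integral_itv_bndoo _ 0 (pi / 2) _ true false); last first.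
    apply/measurable_EFinP; apply: measurable_funM => //.
    apply: measurable_funX; apply: measurable_funTS.
    by apply: continuous_measurable_fun; exact: continuous_sin.
  under eq_integral do rewrite EFinM.
  rewrite integralZl; [|exact: measurable_itv|exact: int_sin].
  rewrite -[X in (_ * X)%E]fineK; last first.
    by apply: (integrable_fin_num _ int_sin); exact: measurable_itv.
  have pi2E : 2 * pi / 2 = pi :> R by field.
  have := @wallis_integral R m; rewrite /Rintegral => ->.
  by rewrite -EFinM !mulrA pi2E.
- move=> t _.
  have : is_derive t (1 : R) (@sin R ^+ 2) (2 * sin t * cos t).
    by apply: is_derive_eq; rewrite /GRing.scale/= expr1.
  by [].
- move=> t _; apply: cvgM; last exact: continuous_cos.
  by apply: cvgM; [exact: cvg_cst|exact: continuous_sin].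
- apply: (@continuous_comp _ _ _ sin (fun x : R => x ^+ 2)).
    exact: continuous_sin.
  exact: exprn_continuous.
- apply: (@continuous_comp _ _ _ sin (fun x : R => x ^+ 2)).
    exact: continuous_sin.
  exact: exprn_continuous.
- by move=> t tpi; rewrite !mulr_gt0 ?sin0pi2 ?cos0pi2.
- move=> u; rewrite in_itv/= => u01; apply: cvgM; last exact: exprn_continuous.
  exact: continuous_arcsine_weight.
- move=> u; rewrite in_itv/= => /andP[u0 _].
  by rewrite mulr_ge0 ?arcsine_weight_ge0// exprn_ge0// ltW.
Qed.

(** * The binomial series *)

(** The coefficient of [t^i] in [(1 - t)^(- b)], that is, the generalized binomial
    coefficient [(-1)^i C(- b, i)]. *)
Definition binomial_coeff {R : realType} (b : R) (i : nat) : R := pochhammer b i / i`!%:R.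

Lemma binomial_coeffS {R : realType} (b : R) i :
  i.+1%:R * binomial_coeff b i.+1 = (b + i%:R) * binomial_coeff b i.
Proof.
rewrite /binomial_coeff pochhammerS factS natrM; field.
by rewrite !pnatr_eq0 -lt0n fact_gt0/= nat1r pnatr_eq0.
Qed.

Lemma pochhammerSl {R : realType} (b : R) i :
  pochhammer b i.+1 = b * pochhammer (b + 1) i.
Proof.
rewrite /pochhammer big_ord_recl addr0; congr (_ * _); apply: eq_bigr => j _.
by rewrite /bump/= natrD addrA.
Qed.

(** Termwise differentiation multiplies by [b] and raises the parameter by one.  The
    derived series is thus again a binomial series, and the convergence hypotheses on
    the first and second derived series come for free. *)
Lemma pseries_diffs_binomial_coeff {R : realType} (b : R) :
  pseries_diffs (binomial_coeff b) = (fun i => b * binomial_coeff (b + 1) i).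
Proof.
apply/funext => i; rewrite /pseries_diffs /binomial_coeff pochhammerSl factS natrM.
by field; rewrite !pnatr_eq0 -lt0n fact_gt0/= nat1r pnatr_eq0.
Qed.

(** The ratio of consecutive terms is [r |b + i| / (i + 1)], which is at most 1 from
    some rank on because [r < 1]. *)
Lemma binomial_coeff_growth {R : realType} (b r : R) : 0 < r < 1 ->
  exists M, forall i, `|binomial_coeff b i| * r ^+ i <= M.
Proof.
move=> /andP[r0 r1]; have r1' : 0 < 1 - r by rewrite subr_gt0.
pose N := (Num.truncn (`|b| / (1 - r))).+1.
have NP : `|b| / (1 - r) < N%:R by rewrite truncnS_gt.
pose u i := `|binomial_coeff b i| * r ^+ i.
have u0 i : 0 <= u i by rewrite mulr_ge0 ?exprn_ge0// ltW.
have dec i : (N <= i)%N -> u i.+1 <= u i.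
  move=> Ni; have i0 : (0 : R) < i.+1%:R by rewrite ltr0n.
  rewrite -(ler_pM2l i0) /u -(ger0_norm (ltW i0)) mulrA -normrM binomial_coeffS.
  rewrite normrM exprS (ger0_norm (ltW i0)).
  rewrite (_ : _ * _ * (r * _) = (`|b + i%:R| * r) * u i); last by rewrite /u; ring.
  rewrite ler_wpM2r//.
  apply: le_trans (_ : (`|b| + i%:R) * r <= _).
    by rewrite ler_pM2r// (le_trans (ler_normD _ _))// [X in _ + X]ger0_norm.
  have : `|b| < i%:R * (1 - r).
    rewrite -ltr_pdivrMr//; apply: lt_le_trans NP _; by rewrite ler_nat.
  rewrite -natr1; have := normr_ge0 b; nra.
have decN i : u (N + i)%N <= u N.
  elim: i => [|i IH]; first by rewrite addn0.
  by rewrite addnS (le_trans _ IH)// dec// leq_addr.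
have le_sum i : (i <= N)%N -> u i <= \sum_(j < N.+1) u j.
  rewrite -ltnS => iN; rewrite (bigD1 (Ordinal iN))//=.
  by rewrite lerDl sumr_ge0.
exists (\sum_(j < N.+1) u j) => i; rewrite -/(u i).
have [iN|/ltnW Ni] := leqP i N; first exact: le_sum.
by rewrite -(subnKC Ni) (le_trans (decN _))// le_sum.
Qed.

Lemma is_cvg_normed_binomial_series {R : realType} (b t : R) : `|t| < 1 ->
  cvgn (series (fun i => `|binomial_coeff b i * t ^+ i|)).
Proof.
move=> t1; pose r := (1 + `|t|) / 2.
have t0 := normr_ge0 t.
have r01 : 0 < r < 1 by rewrite /r; apply/andP; split; lra.
have [r0 r1] := andP r01.
have tr : `|t| < r by rewrite /r; lra.
have [M MP] := binomial_coeff_growth b r r01.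
apply: (@series_le_cvg _ _ (geometric M (`|t| / r))) => //.
- move=> n; rewrite /geometric/= mulr_ge0 ?exprn_ge0 ?divr_ge0 ?(ltW r0)//.
  by apply: le_trans (MP 0%N); rewrite mulr_ge0 ?exprn_ge0// ltW.
- move=> n; rewrite /geometric/= normrM normrX.
  have -> : `|t| ^+ n = r ^+ n * (`|t| / r) ^+ n.
    by rewrite -exprMn mulrCA divff ?mulr1// gt_eqF.
  by rewrite mulrA ler_wpM2r// exprn_ge0// divr_ge0// ltW.
- apply: is_cvg_geometric_series.
  by rewrite ger0_norm ?divr_ge0 ?(ltW r0)// ltr_pdivrMr// mul1r.
Qed.

Lemma is_cvg_binomial_series {R : realType} (b t : R) : `|t| < 1 ->
  cvgn (pseries (binomial_coeff b) t).
Proof. by move=> t1; apply: normed_cvg; exact: is_cvg_normed_binomial_series. Qed.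

(** This is Pascal's rule for the coefficients; together with
    [is_derive_binomial_series] it gives the differential equation
    [(1 - t) f' = b f] of [(1 - t)^(- b)]. *)
Lemma binomial_series_shift {R : realType} (b t : R) : `|t| < 1 ->
  limn (pseries (binomial_coeff b) t) =
  (1 - t) * limn (pseries (binomial_coeff (b + 1)) t).
Proof.
move=> t1; apply/cvg_lim => //; rewrite -cvg_shiftS/=.
have partial n : pseries (binomial_coeff b) t n.+1 =
    (1 - t) * pseries (binomial_coeff (b + 1)) t n.+1
    + binomial_coeff (b + 1) n * t ^+ n * t.
  rewrite /pseries/series/=; elim: n => [|n IH].
    by rewrite !big_nat1 /binomial_coeff /pochhammer !big_ord0 fact0; field.
  rewrite big_nat_recr//= IH [in RHS]big_nat_recr//= exprS.
  have n0 : (n.+1%:R : R) != 0 by rewrite pnatr_eq0.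
  have -> : binomial_coeff b n.+1 =
      binomial_coeff (b + 1) n.+1 - binomial_coeff (b + 1) n.
    apply: (mulfI n0); rewrite mulrBr [_ * binomial_coeff (b + 1) n.+1]binomial_coeffS.
    have := congr1 (fun f => f n) (pseries_diffs_binomial_coeff b).
    by rewrite /pseries_diffs => ->; ring.
  ring.
rewrite (_ : (fun _ => _) = (fun n => (1 - t) * pseries (binomial_coeff (b + 1)) t n.+1
    + binomial_coeff (b + 1) n * t ^+ n * t)); last exact/funext.
rewrite (_ : (1 - t) * limn _ =
  (1 - t) * limn (pseries (binomial_coeff (b + 1)) t) + 0 * t); last by rewrite mul0r addr0.
have cvg1 := is_cvg_binomial_series (b + 1) t t1.
apply: cvgD; apply: cvgM; try exact: cvg_cst.
  by rewrite (cvg_shiftS (pseries (binomial_coeff (b + 1)) t)).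
exact: cvg_series_cvg_0.
Qed.

Lemma is_derive_binomial_series {R : realType} (b t : R) : `|t| < 1 ->
  is_derive t (1 : R) (fun x => limn (pseries (binomial_coeff b) x))
    (b * limn (pseries (binomial_coeff (b + 1)) t)).
Proof.
move=> t1; have t0 := normr_ge0 t.
pose K := (1 + `|t|) / 2.
have K0 : 0 <= K by rewrite /K; lra.
have K1 : `|K| < 1 by rewrite ger0_norm// /K; lra.
have tK : `|t| < `|K| by rewrite (ger0_norm K0) /K; lra.
have pseriesZ (c : R) (f : nat -> R) (x : R) :
    pseries (fun i => c * f i) x = (c *: pseries f x).
  apply/funext => n; rewrite /pseries/series/= fctE /GRing.scale/= mulr_sumr.
  by apply: eq_bigr => i _; rewrite mulrA.
have cvgZ (c d x : R) : `|x| < 1 -> cvgn (pseries (fun i => c * binomial_coeff d i) x).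
  move=> x1; rewrite (pseriesZ c (binomial_coeff d)); apply: is_cvgZr.
  exact: is_cvg_binomial_series.
have diffZ (c : R) (f : nat -> R) :
    pseries_diffs (fun i => c * f i) = (fun i => c * pseries_diffs f i).
  by apply/funext => i; rewrite /pseries_diffs mulrCA.
have := @pseries_snd_diffs R (binomial_coeff b) K t.
rewrite pseries_diffs_binomial_coeff diffZ pseries_diffs_binomial_coeff.
move=> /(_ (is_cvg_binomial_series _ _ K1) (cvgZ _ _ _ K1)).
have -> : limn (pseries (fun i => b * binomial_coeff (b + 1) i) t) =
    b * limn (pseries (binomial_coeff (b + 1)) t).
  by rewrite (pseriesZ b (binomial_coeff (b + 1))) limZr//; exact: is_cvg_binomial_series.
apply => //.
rewrite (_ : (fun _ => _) = (fun i => (b * (b + 1)) * binomial_coeff (b + 1 + 1) i)).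
  exact: cvgZ.
by apply/funext => i; rewrite mulrA.
Qed.

(** The product of the sum of the series and [(1 - t)^b] has derivative zero by the
    differential equation, and equals 1 at [t = 0]. *)
Lemma cvg_binomial_series {R : realType} (b t : R) : `|t| < 1 ->
  pseries (binomial_coeff b) t @ \oo --> (1 - t) `^ (- b).
Proof.
move=> t1.
pose g (x : R) := limn (pseries (binomial_coeff b) x) * (1 - x) `^ b.
have pos1 (x : R) : `|x| < 1 -> 0 < 1 - x.
  by rewrite ltr_norml => /andP[_]; rewrite subr_gt0.
have dg (x : R) : `|x| < 1 -> is_derive x (1 : R) g 0.
  move=> x1; have x0 := pos1 _ x1.
  have dS := is_derive_binomial_series b x x1.
  have dP : is_derive x (1 : R) ((fun y : R => y `^ b) \o (fun y => 1 - y))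
      (b * (1 - x) `^ (b - 1) * -1).
    apply: is_derive1_comp; first exact: is_derive1_powR.
    by have := is_deriveB (is_derive_cst (1 : R) x (1 : R)) (is_derive_id x (1 : R)); rewrite sub0r.
  apply: (is_derive_eq (is_deriveM dS dP)).
  rewrite /GRing.scale/= (binomial_series_shift _ _ x1).
  rewrite powRB; last by rewrite (gt_eqF x0) implybT.
  by rewrite powRr1 ?(ltW x0)//; field; rewrite gt_eqF.
have g0 : g 0 = 1.
  rewrite /g subr0 powR1 mulr1; apply/cvg_lim => //.
  rewrite -cvg_shiftS; apply: cvg_near_cst; near=> n.
  rewrite /pseries/series/= big_nat_recl// big1 ?addr0.
    by rewrite /binomial_coeff /pochhammer big_ord0 fact0 expr0 divr1 mulr1.
  by move=> i _; rewrite expr0n/= mulr0.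
have gcst (x y : R) : x <= y -> -1 < x -> y < 1 -> g x = g y.
  move=> xy x1 y1.
  have dgxy z : z \in `[x, y] -> is_derive z (1 : R) g 0.
    rewrite in_itv/= => /andP[xz zy]; apply: dg.
    by rewrite ltr_norml (lt_le_trans x1)// (le_lt_trans zy).
  have cg : {within `[x, y], continuous g}.
    by apply: derivable_within_continuous => z /dgxy[].
  have [z _] := @MVT_segment R g (fun=> 0) x y xy (fun z zxy => dgxy z (subset_itv_oo_cc zxy)) cg.
  by rewrite mul0r => /eqP; rewrite subr_eq0 => /eqP.
have g1 : g t = 1.
  move: (t1); rewrite ltr_norml => /andP[tN1 t1'].
  by have [t0|/ltW t0] := leP 0 t; [rewrite -(gcst 0)|rewrite (gcst t 0)]; rewrite ?ltrN10.
have := is_cvg_binomial_series b t t1.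
rewrite powRN (_ : _^-1 = limn (pseries (binomial_coeff b) t))//.
apply: (mulIf (_ : (1 - t) `^ b != 0)); first by rewrite gt_eqF// powR_gt0// pos1.
by rewrite -/(g t) g1 mulVf// gt_eqF// powR_gt0// pos1.
Unshelve. all: by end_near. Qed.

(** * The Lauricella function for alpha = 1/2 and gamma = 1 *)

Lemma integrable_arcsine_moment {R : realType} (m : nat) :
  (@lebesgue_measure R).-integrable `[0, 1]
    (EFin \o (fun u => arcsine_weight u * u ^+ m)).
Proof.
apply/integrableP; split.
  apply/measurable_EFinP; apply: measurable_funM; first exact: measurable_arcsine_weight.
  exact: measurable_funX.
rewrite (_ : integral _ _ _ =
  \int[lebesgue_measure]_(u in `[0%R, 1%R]) (arcsine_weight u * u ^+ m)%:E)%E.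
  by rewrite arcsine_moment ltry.
apply: eq_integral => u; rewrite inE/= in_itv/= => /andP[u0 _].
by rewrite ger0_norm// mulr_ge0 ?arcsine_weight_ge0// exprn_ge0.
Qed.

Section lauricella_arcsine.
Context {R : realType} (n : nat) (beta x : n.-tuple R).

Let coeff (m : 'I_n -> nat) :=
  \prod_(j < n) (binomial_coeff (tnth beta j) (m j) * tnth x j ^+ m j).

Let truncated_kernel (N : nat) (u : R) := arcsine_weight u *
  \prod_(j < n) pseries (binomial_coeff (tnth beta j)) (tnth x j * u) N.

Let lauricella_termE m : pi * lauricella_term (1 / 2) beta 1 x m =
  coeff m * (pi * (pochhammer (1 / 2) (\sum_(j < n) m j)
                   / pochhammer 1 (\sum_(j < n) m j))).
Proof.
rewrite /lauricella_term /coeff big_split/= big_split/= prodfV.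
rewrite invfM; ring.
Qed.

Let truncated_kernelE N u : truncated_kernel N u =
  \sum_(m : {ffun 'I_n -> 'I_N})
    coeff (fun j => m j) * (arcsine_weight u * u ^+ (\sum_(j < n) m j)%N).
Proof.
rewrite /truncated_kernel /pseries/series/=.
under eq_bigr do rewrite big_mkord.
rewrite bigA_distr_bigA/= mulr_sumr; apply: eq_bigr => m _.
rewrite mulrCA; congr (_ * _).
rewrite -prodrXr -big_split/=; apply: eq_bigr => j _.
by rewrite exprMn mulrA.
Qed.

Let integral_truncated_kernel N :
  (\int[lebesgue_measure]_(u in `[0%R, 1%R]) (truncated_kernel N u)%:E =
  (pi * \sum_(m : {ffun 'I_n -> 'I_N})
    lauricella_term (1 / 2) beta 1 x (fun j => nat_of_ord (m j)))%:E)%E.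
Proof.
under eq_integral do rewrite truncated_kernelE -sumEFin.
rewrite integral_sum//; last first.
  move=> m; rewrite (_ : (fun _ => _) = (fun u => (coeff (fun j => m j))%:E *
      (arcsine_weight u * u ^+ (\sum_(j < n) m j)%N)%:E)%E).
    by apply: integrableZl; [exact: measurable_itv|exact: integrable_arcsine_moment].
  by apply/funext => u; rewrite EFinM.
rewrite mulr_sumr -sumEFin; apply: eq_bigr => m _.
under eq_integral do rewrite EFinM.
rewrite integralZl; [|exact: measurable_itv|exact: integrable_arcsine_moment].
by rewrite arcsine_moment -EFinM lauricella_termE.
Qed.

Hypothesis x1 : forall j, `|tnth x j| < 1.

Let bound j := limn (series (fun i => `|binomial_coeff (tnth beta j) i * tnth x j ^+ i|)).

Let xu1 j u : u \in `[0, 1] -> `|tnth x j * u| < 1.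
Proof.
rewrite in_itv/= => /andP[u0 u1]; rewrite normrM (ger0_norm u0).
by rewrite (le_lt_trans _ (x1 j))// ler_piMr.
Qed.

Let pseries_le_bound j u N : u \in `[0, 1] ->
  `|pseries (binomial_coeff (tnth beta j)) (tnth x j * u) N| <= bound j.
Proof.
rewrite in_itv/= => /andP[u0 u1].
apply: (@le_trans _ _ (series (fun i =>
    `|binomial_coeff (tnth beta j) i * tnth x j ^+ i|) N)).
  rewrite /pseries/series/= (le_trans (ler_norm_sum _ _ _))//.
  apply: ler_sum => i _; rewrite exprMn mulrA normrM ler_piMr//.
  by rewrite normrX ger0_norm// exprn_ile1.
apply: nondecreasing_cvgn_le; last exact: is_cvg_normed_binomial_series.
by apply: nondecreasing_series => i _ _.
Qed.

(** Summing over the cube of side [N] amounts to replacing each factor of the kernel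
    by the [N]-th partial sum of its binomial series.  For [u] in the unit interval
    these partial sums are bounded by the absolute sums at [x_j], so dominated
    convergence applies with a multiple of the arcsine weight as majorant. *)
Lemma lauricella_series_arcsine :
  lauricella_series (1 / 2) beta 1 x =
  pi^-1 * \int[lebesgue_measure]_(u in `[0, 1])
    (u `^ (1 / 2 - 1) * (1 - u) `^ (1 - 1 / 2 - 1)
     / \prod_(j < n) (1 - tnth x j * u) `^ (tnth beta j)).
Proof.
transitivity (pi^-1 * \int[lebesgue_measure]_(u in `[0, 1])
    (arcsine_weight u * \prod_(j < n) (1 - tnth x j * u) `^ (- tnth beta j))); last first.
  congr (_ * _); apply: eq_Rintegral => u _; rewrite -prodfV; congr (_ * _).
  by apply: eq_bigr => j _; rewrite powRN.
have pi0 : pi != 0 :> R by rewrite gt_eqF ?pi_gt0.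
pose f (u : R) := arcsine_weight u * \prod_(j < n) (1 - tnth x j * u) `^ (- tnth beta j).
rewrite -/f.
have mf : measurable_fun (`[0, 1]%classic : set R) f.
  apply: measurable_funM; first exact: measurable_arcsine_weight.
  apply: measurable_prod => j _.
  apply: (@measurableT_comp _ _ _ _ _ _ (fun y : R => y `^ _)).
    exact: measurable_powR.
  by apply: measurable_funB => //; exact: measurable_funM.
have mfN N : measurable_fun (`[0, 1]%classic : set R) (truncated_kernel N).
  apply: measurable_funM; first exact: measurable_arcsine_weight.
  apply: measurable_prod => j _.
  apply: measurable_sum => i; apply: measurable_funM => //.
  by apply: measurable_funX; exact: measurable_funM.
have [] := @dominated_convergence _ _ R lebesgue_measure `[0, 1]%classic
  (measurable_itv _) (fun N => EFin \o truncated_kernel N) (EFin \o f)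
  (fun u => (\prod_(j < n) bound j)%:E * (arcsine_weight u * u ^+ 0)%:E)%E.
- by move=> N; apply/measurable_EFinP; exact: mfN.
- by apply/measurable_EFinP; exact: mf.
- apply: aeW => u u01; apply: cvg_EFin; first exact: nearW.
  apply: cvgM; first exact: cvg_cst.
  apply: cvg_big => [|j _]; first exact: mul_continuous.
  exact/cvg_binomial_series/xu1.
- by apply: integrableZl; [exact: measurable_itv|exact: integrable_arcsine_moment].
- apply: aeW => u N u01; rewrite -EFinM lee_fin expr0 mulr1 mulrC normrM.
  rewrite (ger0_norm (arcsine_weight_ge0 _)) ler_wpM2l ?arcsine_weight_ge0//.
  by rewrite normr_prod ler_prod// => j _; rewrite normr_ge0 pseries_le_bound.
move=> intf _.
under eq_fun do rewrite integral_truncated_kernel.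
have <- : (\int[lebesgue_measure]_(u in `[0, 1]) f u)%:E =
    (\int[lebesgue_measure]_(u in `[0%R, 1%R]) (EFin \o f) u)%E.
  by rewrite fineK//; apply: integrable_fin_num => //.
move=> /fine_cvg/= H.
apply/cvg_lim => //.
rewrite (_ : (fun _ => _) = (fun N => pi^-1 * (pi * \sum_(m : {ffun 'I_n -> 'I_N})
    lauricella_term (1 / 2) beta 1 x (fun j => nat_of_ord (m j))))).
  by apply: cvgM; [exact: cvg_cst|].
by apply/funext => N; rewrite mulKf.
Qed.

End lauricella_arcsine.

(** On the region of convergence the series agrees with Euler's integral, and outside
    of it the latter is the definition; the constant is
    [Gamma 1 / Gamma (1/2) ^+ 2 = 1 / pi]. *)
Lemma lauricellaFD_half_one {R : realType} n (beta x : n.-tuple R) :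
  lauricellaFD (1 / 2) beta 1 x =
  pi^-1 * \int[lebesgue_measure]_(u in `[0, 1])
    (u `^ (1 / 2 - 1) * (1 - u) `^ (1 - 1 / 2 - 1)
     / \prod_(j < n) (1 - tnth x j * u) `^ (tnth beta j)).
Proof.
rewrite /lauricellaFD; case: ifPn => [/forallP x1|_].
  exact: lauricella_series_arcsine.
rewrite /lauricella_integral Gamma1 Gamma_half.
have -> : 1 - 1 / 2 = 1 / 2 :> R by field.
by rewrite Gamma_half -expr2 sqr_sqrtr ?pi_ge0// (div1r pi).
Qed.

(** * Elliptic integrals *)

Lemma continuous_div_sqrt {R : realType} (n d : R -> R) (x : R) :
  {for x, continuous n} -> {for x, continuous d} -> 0 < d x ->
  {for x, continuous (fun y => n y / Num.sqrt (d y))}.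
Proof.
move=> cn cd d0; apply: cvgM => //; apply: cvgV.
  by rewrite gt_eqF// sqrtr_gt0.
apply: (@continuous_comp _ _ _ d Num.sqrt) => //; exact: sqrt_continuous.
Qed.

Section polynomial_continuity.
Context {R : realType} (f g : R -> R) (x : R).
Hypotheses (cf : continuous_at x f) (cg : continuous_at x g).

Lemma continuous_at_add : continuous_at x (fun y => f y + g y).
Proof. exact: cvgD. Qed.

Lemma continuous_at_opp : continuous_at x (fun y => - f y).
Proof. exact: cvgN. Qed.

Lemma continuous_at_mul : continuous_at x (fun y => f y * g y).
Proof. exact: cvgM. Qed.

Lemma continuous_at_exp n : continuous_at x (fun y => f y ^+ n).
Proof.
apply: (@continuous_comp _ _ _ f (fun y : R => y ^+ n)) => //.
exact: exprn_continuous.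
Qed.

Lemma continuous_at_inv : f x != 0 -> continuous_at x (fun y => (f y)^-1).
Proof. by move=> fx0; exact: cvgV. Qed.

End polynomial_continuity.

(* The case is chosen by the head symbol of the function body; leaving the
   choice to unification would unfold the ring operations. *)
Ltac polynomial_continuity_of f x :=
  lazymatch f with
  | (fun _ => ?c) => exact: (@cvg_cst _ c _ (nbhs x))
  | (fun y => y) => exact: cvg_id
  | (fun y => @?g y + @?h y) => refine (@continuous_at_add _ g h x _ _);
      [polynomial_continuity_of g x | polynomial_continuity_of h x]
  | (fun y => - @?g y) => refine (@continuous_at_opp _ g x _);
      polynomial_continuity_of g x
  | (fun y => @?g y * @?h y) => refine (@continuous_at_mul _ g h x _ _);
      [polynomial_continuity_of g x | polynomial_continuity_of h x]
  | (fun y => @?g y ^+ ?n) => refine (@continuous_at_exp _ g x _ n);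
      polynomial_continuity_of g x
  end.

Ltac polynomial_continuity :=
  lazymatch goal with
  | |- continuous_at ?x ?f =>
      let f' := eval cbv beta in f in polynomial_continuity_of f' x
  | |- {for ?x, continuous ?f} =>
      let f' := eval cbv beta in f in polynomial_continuity_of f' x
  end.

Section elliptic.
Context {R : realType} (k : R).
Hypothesis k01 : 0 <= k < 1.

Let intK (x : R) := 1 / Num.sqrt ((1 - x ^+ 2) * (1 - k ^+ 2 * x ^+ 2)).
Let intE (x : R) := Num.sqrt ((1 - k ^+ 2 * x ^+ 2) / (1 - x ^+ 2)).

Let k2_lt1 : k ^+ 2 < 1.
Proof. by have /andP[k0 k1] := k01; rewrite expr_lt1. Qed.

Let radicand_gt0 x : 0 <= x <= 1 -> 0 < 1 - k ^+ 2 * x ^+ 2.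
Proof.
move=> /andP[x0 x1]; rewrite subr_gt0 (le_lt_trans _ k2_lt1)//.
by rewrite ler_piMr ?sqr_ge0// exprn_ile1.
Qed.

Let intE_intK x : 0 <= x <= 1 -> intE x = (1 - k ^+ 2 * x ^+ 2) * intK x.
Proof.
move=> x01; have r0 := radicand_gt0 _ x01.
rewrite /intE /intK div1r sqrtrM ?(ltW r0)//.
have /andP[x0 x1] := x01.
have x2 : 0 <= 1 - x ^+ 2 by rewrite subr_ge0 exprn_ile1.
rewrite sqrtrV// sqrtrM// invfM [RHS]mulrCA.
have s0 : Num.sqrt (1 - k ^+ 2 * x ^+ 2) != 0 by rewrite gt_eqF ?sqrtr_gt0.
by rewrite -[X in _ = _ * (X / _)](sqr_sqrtr (ltW r0)) expr2 mulfK// mulrC.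
Qed.

Let radicand2_gt0 x : x \in `]0, 1[ -> 0 < (1 - x ^+ 2) * (1 - k ^+ 2 * x ^+ 2).
Proof.
rewrite in_itv/= => /andP[x0 x1]; rewrite mulr_gt0 ?radicand_gt0 ?(ltW x0) ?(ltW x1)//.
by rewrite subr_gt0 expr_lt1// ltW.
Qed.

Let continuous_intK : {in `]0, 1[, continuous intK}.
Proof.
move=> x x01; apply: (@continuous_div_sqrt _ (fun=> 1)
  (fun x => (1 - x ^+ 2) * (1 - k ^+ 2 * x ^+ 2))); last exact: radicand2_gt0.
  by polynomial_continuity.
by polynomial_continuity.
Qed.

Let measurable_intK : measurable_fun (`]0, 1[%classic : set R) intK.
Proof. by apply: continuous_in_measurable => // x /[!inE]; exact: continuous_intK. Qed.

Let itv_oo01 (x : R) : x \in `]0, 1[ -> 0 <= x <= 1.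
Proof. by rewrite in_itv/= => /andP[/ltW-> /ltW->]. Qed.

Let measurable_intE : measurable_fun (`]0, 1[%classic : set R) intE.
Proof.
have : measurable_fun (`]0, 1[%classic : set R) (fun x => (1 - k ^+ 2 * x ^+ 2) * intK x).
  apply: continuous_in_measurable => // x /[!inE] x01.
  by apply: continuous_at_mul; [polynomial_continuity|exact: continuous_intK].
by apply: eq_measurable_fun => x; rewrite inE => /itv_oo01 x01; rewrite intE_intK.
Qed.

(** [x (1 - x) <= (1 - x) (1 + x)] and [1 - k^2 <= 1 - k^2 x^2]. *)
Let intK_le x : x \in `]0, 1[ -> intK x <= (Num.sqrt (1 - k ^+ 2))^-1 * arcsine_weight x.
Proof.
move=> /[dup] x01; rewrite in_itv/= => /andP[x0 x1].
have k2 : 0 < 1 - k ^+ 2 by rewrite subr_gt0.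
have x1' : 0 < 1 - x by rewrite subr_gt0.
rewrite arcsine_weightE ?x0// -invfM -sqrtrM ?(ltW k2)// /intK div1r.
rewrite lef_pV2 ?posrE ?sqrtr_gt0 ?radicand2_gt0 ?mulr_gt0//.
rewrite ler_sqrt ?(ltW (radicand2_gt0 _ x01))// mulrC.
rewrite ler_pM ?mulr_ge0 ?(ltW x0) ?(ltW x1') ?(ltW k2)//.
  by nra.
by rewrite lerD2l lerN2 ler_piMr ?sqr_ge0// exprn_ile1// ?(ltW x0) ?(ltW x1).
Qed.

Let intK_ge0 x : 0 <= intK x.
Proof. by rewrite /intK divr_ge0. Qed.

Let integrable_intK :
  (@lebesgue_measure R).-integrable `]0, 1[ (EFin \o intK).
Proof.
apply: (@le_integrable _ _ _ lebesgue_measure _ _ _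
  (fun x => (Num.sqrt (1 - k ^+ 2))^-1%:E * (arcsine_weight x * x ^+ 0)%:E)%E).
- exact: measurable_itv.
- by apply/measurable_EFinP; exact: measurable_intK.
- move=> x x01; rewrite -EFinM /= lee_fin expr0 mulr1 !ger0_norm//.
    exact: intK_le.
  by rewrite mulr_ge0 ?invr_ge0 ?sqrtr_ge0// arcsine_weight_ge0.
- apply: integrableZl; first exact: measurable_itv.
  by apply: integrableS (integrable_arcsine_moment 0) => //; exact: subset_itv_oo_cc.
Qed.

Let integrable_intE :
  (@lebesgue_measure R).-integrable `]0, 1[ (EFin \o intE).
Proof.
apply: le_integrable integrable_intK.
- exact: measurable_itv.
- by apply/measurable_EFinP; exact: measurable_intE.
- move=> x x01; rewrite /= lee_fin; have x01' := itv_oo01 _ x01.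
  rewrite intE_intK// normrM ler_piMl// ger0_norm ?(ltW (radicand_gt0 _ x01'))//.
  by rewrite gerBl mulr_ge0 ?sqr_ge0.
Qed.

(** The integrand of [E] is [1 - k^2 x^2] times that of [K], hence [k^2 x^2] times the
    latter integrates to [K - E]. *)
Lemma elliptic_combination (c : R) :
  (\int[lebesgue_measure]_(x in `]0%R, 1%R[)
    ((1 + c * (k ^+ 2 * x ^+ 2)) / Num.sqrt ((1 - x ^+ 2) * (1 - k ^+ 2 * x ^+ 2)))%:E =
   ((1 + c) * ellipticK k - c * ellipticE k)%:E)%E.
Proof.
have -> : ellipticK k = \int[lebesgue_measure]_(x in `]0, 1[) intK x.
  rewrite /ellipticK /Rintegral integral_itv_bndoo//.
  by apply/measurable_EFinP; exact: measurable_intK.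
have -> : ellipticE k = \int[lebesgue_measure]_(x in `]0, 1[) intE x.
  rewrite /ellipticE /Rintegral integral_itv_bndoo//.
  by apply/measurable_EFinP; exact: measurable_intE.
have mD : measurable (`]0, 1[%classic : set R) by exact: measurable_itv.
have iK (d : R) : (@lebesgue_measure R).-integrable `]0, 1[ (EFin \o (fun x => d * intK x)).
  by rewrite (_ : _ \o _ = (fun x => d%:E * (intK x)%:E)%E);
    [exact: integrableZl|apply/funext => x /=; rewrite EFinM].
have iE (d : R) : (@lebesgue_measure R).-integrable `]0, 1[ (EFin \o (fun x => d * intE x)).
  by rewrite (_ : _ \o _ = (fun x => d%:E * (intE x)%:E)%E);
    [exact: integrableZl|apply/funext => x /=; rewrite EFinM].
rewrite -!RintegralZl// -RintegralB// /Rintegral fineK.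
  apply: eq_integral => x; rewrite inE => /itv_oo01 x01; congr EFin.
  by rewrite intE_intK// /intK; ring.
apply: integrable_fin_num => //.
have iB := fun m => @integrableB _ _ R lebesgue_measure _ m _ _ (iK (1 + c)) (iE c).
by apply: iB; exact: measurable_itv.
Qed.

End elliptic.

(** * Folding the hyperelliptic integral *)

Section reduction.
Context {R : realType} (a b : R).
Hypothesis a_gt1 : 1 < a.
Hypothesis ab : a < b.

Let a0 : 0 < a. Proof. exact: lt_trans a_gt1. Qed.
Let b_gt1 : 1 < b. Proof. exact: lt_trans a_gt1 ab. Qed.
Let b0 : 0 < b. Proof. exact: lt_trans b_gt1. Qed.
Let a2_gt1 : 0 < a ^+ 2 - 1. Proof. by rewrite subr_gt0 expr_gt1// ltW. Qed.
Let a4_gt1 : 0 < a ^+ 4 - 1. Proof. by rewrite subr_gt0 expr_gt1// ltW. Qed.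
Let b2_gt1 : 0 < b ^+ 2 - 1. Proof. by rewrite subr_gt0 expr_gt1// ltW. Qed.
Let b2a2 : 0 < b ^+ 2 - a ^+ 2. Proof. by rewrite subr_gt0 ltr_pXn2r// nnegrE ltW. Qed.
Let a2b2 : 0 < a ^+ 2 * b ^+ 2 - 1.
Proof. by rewrite -exprMn subr_gt0 expr_gt1 ?mulr_ge0 ?ltW// mulr_egt1. Qed.

Let s := Num.sqrt (b ^+ 2 - a ^+ 2) * Num.sqrt (a ^+ 2 * b ^+ 2 - 1).

Let s0 : 0 < s. Proof. by rewrite mulr_gt0// sqrtr_gt0. Qed.

Let s2E : s ^+ 2 = (b ^+ 2 - a ^+ 2) * (a ^+ 2 * b ^+ 2 - 1).
Proof. by rewrite exprMn !sqr_sqrtr// ltW. Qed.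

Let x1 := 1 - a ^+ 4.
Let x2 := ((a ^+ 4 - 1) * b ^+ 2) / (a ^+ 2 - b ^+ 2).
Let x3 := (a ^+ 4 - 1) / (a ^+ 2 * b ^+ 2 - 1).

(** The kernel is written as one quotient with a single square root, the power 3/2
    of the first factor being its square divided by its root. *)
Let D (u : R) := u * (1 - u) * (1 - x1 * u) * (1 - x2 * u) * (1 - x3 * u).
Let g (u : R) := (1 - x1 * u) ^+ 2 / Num.sqrt (D u).

(** Up to a square factor, what the radicand becomes in the parameter [p]; up to such
    a factor it is invariant under [p -> 1 / p]. *)
Let P (p : R) := (a ^+ 2 * p ^+ 2 - 1) * (a ^+ 2 - p ^+ 2)
  * ((b ^+ 2 * p ^+ 2 - 1) * (b ^+ 2 - p ^+ 2)).

(** These are [w = a^2 p^2] and its image [w = a^2 / p^2] under the involution,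
    expressed in [u]. *)
Let u_right (p : R) := (a ^+ 2 * p ^+ 2 - 1) / (a ^+ 4 - 1).
Let u_left (p : R) := (a ^+ 2 * p ^- 2 - 1) / (a ^+ 4 - 1).
Let k := (b * (a ^+ 2 - 1)) / (a * (b ^+ 2 - 1)).
(** The function [p - 1 / p] is anti-invariant under the involution; it is scaled to
    run from 0 to 1 when [p] runs from 1 to [a]. *)
Let x_of (p : R) := (p - p^-1) * (a / (a ^+ 2 - 1)).
(** The coefficient is chosen so that its product with [k^2] is [(a - 1/a)^2]. *)
Let h (x : R) := (1 + ((b ^+ 2 - 1) / b) ^+ 2 * (k ^+ 2 * x ^+ 2))
   / Num.sqrt ((1 - x ^+ 2) * (1 - k ^+ 2 * x ^+ 2)).

Let P_gt0 p : 1 < p < a -> 0 < P p.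
Proof.
move=> /andP[p1 pa]; have p0 : 0 < p by exact: lt_trans p1.
have p21 : 1 < p ^+ 2 by rewrite expr_gt1// ltW.
have p2a : p ^+ 2 < a ^+ 2 by rewrite ltr_pXn2r// nnegrE ltW.
have : 0 < a ^+ 2 - p ^+ 2 by rewrite subr_gt0.
have : 0 < a ^+ 2 * p ^+ 2 - 1 by rewrite subr_gt0 mulr_egt1// -subr_gt0.
have : 0 < b ^+ 2 * p ^+ 2 - 1 by rewrite subr_gt0 mulr_egt1// -subr_gt0.
have : 0 < b ^+ 2 - p ^+ 2 by have := b2a2; lra.
by move=> ? ? ? ?; rewrite /P !mulr_gt0.
Qed.

Let a2b2N : (a ^+ 2 - b ^+ 2 == 0) = false.
Proof. by rewrite -opprB oppr_eq0 gt_eqF. Qed.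

Let ab2_gt1 : 0 < (a * b) ^+ 2 - 1.
Proof. by rewrite exprMn. Qed.

(** The nonvanishing facts that clearing denominators asks for. *)
Let denominators := (a2b2N, gt_eqF ab2_gt1, gt_eqF a0, gt_eqF b0, gt_eqF a2_gt1,
  gt_eqF a4_gt1, gt_eqF b2_gt1, gt_eqF b2a2, gt_eqF a2b2, gt_eqF s0).

Let g_right p : 1 < p < a ->
  g (u_right p) * (2 * a ^+ 2 * p / (a ^+ 4 - 1)) = 2 * a ^+ 2 * s * p ^+ 4 / Num.sqrt (P p).
Proof.
move=> p1a; have P0 := P_gt0 _ p1a; have p0 : 0 < p by have /andP[/(lt_trans ltr01)] := p1a.
have DE : D (u_right p) = (a ^+ 4 * p / ((a ^+ 4 - 1) * s)) ^+ 2 * P p.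
  rewrite expr_div_n [((_ - 1) * s) ^+ 2]exprMn s2E /D /u_right /P /x1 /x2 /x3.
  field.
  by rewrite !denominators ?gt_eqF.
rewrite /g DE sqrtrM ?sqr_ge0// sqrtr_sqr gtr0_norm; last first.
  by rewrite !(mulr_gt0, divr_gt0, invr_gt0, exprn_gt0, s0).
rewrite /u_right /x1; field.
by rewrite !denominators ?(gt_eqF p0) ?gt_eqF ?sqrtr_gt0.
Qed.

Let g_left p : 1 < p < a ->
  g (u_left p) * (2 * a ^+ 2 * p ^- 3 / (a ^+ 4 - 1)) = 2 * a ^+ 2 * s * p ^- 2 / Num.sqrt (P p).
Proof.
move=> p1a; have P0 := P_gt0 _ p1a; have p0 : 0 < p by have /andP[/(lt_trans ltr01)] := p1a.
have DE : D (u_left p) = (a ^+ 4 / (p ^+ 5 * (a ^+ 4 - 1) * s)) ^+ 2 * P p.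
  rewrite expr_div_n [(_ * s) ^+ 2]exprMn s2E /D /u_left /P /x1 /x2 /x3.
  field.
  by rewrite !denominators ?gt_eqF.
rewrite /g DE sqrtrM ?sqr_ge0// sqrtr_sqr gtr0_norm; last first.
  by rewrite !(mulr_gt0, divr_gt0, invr_gt0, exprn_gt0, s0).
rewrite /u_left /x1; field.
by rewrite !denominators ?(gt_eqF p0) ?gt_eqF ?sqrtr_gt0.
Qed.

Let h_x_of p : 1 < p < a ->
  h (x_of p) * ((1 + p ^- 2) * (a / (a ^+ 2 - 1))) =
  a * (b ^+ 2 - 1) * (p ^+ 4 + p ^- 2) / Num.sqrt (P p).
Proof.
move=> p1a; have P0 := P_gt0 _ p1a; have p0 : 0 < p by have /andP[/(lt_trans ltr01)] := p1a.
have DE : (1 - x_of p ^+ 2) * (1 - k ^+ 2 * x_of p ^+ 2) =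
    (p ^- 2 / ((a ^+ 2 - 1) * (b ^+ 2 - 1))) ^+ 2 * P p.
  rewrite /x_of /k /P; field.
  by rewrite !denominators ?gt_eqF.
rewrite /h DE sqrtrM ?sqr_ge0// sqrtr_sqr gtr0_norm; last first.
  by rewrite !(mulr_gt0, divr_gt0, invr_gt0, exprn_gt0).
rewrite /x_of /k; field.
by rewrite !denominators ?(gt_eqF p0) ?gt_eqF ?sqrtr_gt0.
Qed.

Let x1_lt0 : x1 < 0. Proof. by rewrite -oppr_gt0 opprB. Qed.

Let x2_lt0 : x2 < 0.
Proof.
rewrite /x2 -[_ - b ^+ 2]opprB invrN mulrN oppr_lt0.
by rewrite divr_gt0// mulr_gt0// exprn_gt0.
Qed.

Let x3_lt1 : x3 < 1.
Proof.
rewrite ltr_pdivrMr// mul1r ltrD2r (_ : a ^+ 4 = a ^+ 2 * a ^+ 2) -?exprD//.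
by rewrite exprD ltr_pM2l ?exprn_gt0// -subr_gt0.
Qed.

Let factor_gt0 (y u : R) : y < 1 -> 0 <= u <= 1 -> 0 < 1 - y * u.
Proof.
move=> y1 /andP[u0 u1]; rewrite subr_gt0.
have [y0|y0] := leP 0 y; first by rewrite (le_lt_trans _ y1)// ler_piMr.
by rewrite (le_lt_trans _ (@ltr01 R))// nmulr_rle0.
Qed.

Let x_lt1 : [/\ x1 < 1, x2 < 1 & x3 < 1].
Proof. by split; rewrite ?x3_lt1// (lt_trans _ (@ltr01 R)). Qed.

Let D_gt0 u : 0 < u < 1 -> 0 < D u.
Proof.
have [l1 l2 l3] := x_lt1.
move=> /andP[u0 u1]; have u01 : 0 <= u <= 1 by rewrite !ltW.
by rewrite /D !mulr_gt0 ?factor_gt0// subr_gt0.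
Qed.

Let continuous_g u : 0 < u < 1 -> {for u, continuous g}.
Proof.
move=> u01; apply: (@continuous_div_sqrt _ (fun u => (1 - x1 * u) ^+ 2) D); last exact: D_gt0.
  by polynomial_continuity.
by rewrite /D; polynomial_continuity.
Qed.

Let k01 : 0 <= k < 1.
Proof.
rewrite /k divr_ge0 ?mulr_ge0 ?(ltW a0) ?(ltW b0) ?(ltW a2_gt1) ?(ltW b2_gt1)//=.
rewrite ltr_pdivrMr ?mulr_gt0// mul1r -subr_gt0.
rewrite (_ : _ - _ = (b - a) * (a * b + 1)); last by ring.
by rewrite mulr_gt0 ?subr_gt0// addr_gt0// mulr_gt0.
Qed.

Let itv_1a (p : R) : p \in `]1, a[ -> 1 < p < a. Proof. by rewrite in_itv. Qed.

(** The fixed point [p = 1] of the involution, in the variable [u]. *)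
Let midpoint := (a ^+ 2 - 1) / (a ^+ 4 - 1).

Let midpoint01 : 0 < midpoint < 1.
Proof.
rewrite divr_gt0//= ltr_pdivrMr// mul1r ltrD2r.
by rewrite ltr_eXn2l.
Qed.

Let u_right1 : u_right 1 = midpoint.
Proof. by rewrite /u_right expr1n mulr1. Qed.
Let u_righta : u_right a = 1.
Proof. by rewrite /u_right -exprD divff// gt_eqF. Qed.
Let u_left1 : u_left 1 = midpoint.
Proof. by rewrite /u_left expr1n invr1 mulr1. Qed.
Let u_lefta : u_left a = 0.
Proof. by rewrite /u_left divff ?subrr ?mul0r// expf_neq0// gt_eqF. Qed.
Let x_of1 : x_of 1 = 0. Proof. by rewrite /x_of invr1 subrr mul0r. Qed.
Let x_ofa : x_of a = 1.
Proof. by rewrite /x_of; field; rewrite !denominators. Qed.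

Let is_derive_u_right (p : R) : is_derive p (1 : R) u_right (2 * a ^+ 2 * p / (a ^+ 4 - 1)).
Proof.
have : is_derive p (1 : R) ((a ^+ 2 / (a ^+ 4 - 1)) \*: (@id R ^+ 2) + cst (- (a ^+ 4 - 1)^-1))
   (2 * a ^+ 2 * p / (a ^+ 4 - 1)).
  by apply: is_derive_eq; rewrite /GRing.scale/= expr1; field; rewrite !denominators.
rewrite (_ : _ + _ = u_right)//; apply/funext => q.
by rewrite !fctE /u_right /= /GRing.scale /=; field; rewrite !denominators.
Qed.

Let is_derive_inv (p : R) : 0 < p -> is_derive p (1 : R) (fun y : R => y^-1) (- p ^- 2).
Proof.
move=> p0; have pn0 : id p != 0 by rewrite /= gt_eqF.
apply: (is_derive_eq (is_deriveV pn0 (is_derive_id p (1 : R)))).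
by rewrite /GRing.scale/= mulr1.
Qed.

Let is_derive_u_left (p : R) : 0 < p ->
  is_derive p (1 : R) u_left (- (2 * a ^+ 2 * p ^- 3 / (a ^+ 4 - 1))).
Proof.
move=> p0; have dV := is_derive_inv _ p0.
have : is_derive p (1 : R)
   ((a ^+ 2 / (a ^+ 4 - 1)) \*: ((fun y : R => y^-1) ^+ 2) + cst (- (a ^+ 4 - 1)^-1))
   (- (2 * a ^+ 2 * p ^- 3 / (a ^+ 4 - 1))).
  by apply: is_derive_eq; rewrite /GRing.scale/= expr1; field; rewrite !denominators gt_eqF.
rewrite (_ : _ + _ = u_left)//; apply/funext => q.
by rewrite !fctE /u_left /= /GRing.scale /= exprVn mulrBl mul1r mulrAC.
Qed.

Let is_derive_x_of (p : R) : 0 < p ->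
  is_derive p (1 : R) x_of ((1 + p ^- 2) * (a / (a ^+ 2 - 1))).
Proof.
move=> p0; have dV := is_derive_inv _ p0.
have : is_derive p (1 : R)
   ((a / (a ^+ 2 - 1)) \*: (@id R - (fun y : R => y^-1)))
   ((1 + p ^- 2) * (a / (a ^+ 2 - 1))).
  by apply: is_derive_eq; rewrite /GRing.scale/= opprK mulrC.
rewrite (_ : _ \*: _ = x_of)//; apply/funext => q.
by rewrite !fctE /x_of /= /GRing.scale /= mulrC.
Qed.

Let itv_1a_gt0 (p : R) : p \in `]1, a[ -> 0 < p.
Proof. by rewrite in_itv => /andP[/(lt_trans ltr01)]. Qed.

Let continuous_of_derive (F : R -> R) (p df : R) :
  is_derive p (1 : R) F df -> {for p, continuous F}.
Proof.
by move=> [dF _]; apply/differentiable_continuous; rewrite -derivable1_diffP.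
Qed.

Let integral_right :
  (\int[lebesgue_measure]_(u in `]midpoint, 1%R[) (g u)%:E =
   \int[lebesgue_measure]_(p in `]1%R, a[)
     (2 * a ^+ 2 * s * p ^+ 4 / Num.sqrt (P p))%:E)%E.
Proof.
have := @ge0_substitution_increasing R u_right
  (fun p => 2 * a ^+ 2 * p / (a ^+ 4 - 1)) g 1 a a_gt1.
rewrite u_right1 u_righta => subst; rewrite (subst _ _ _ _ _ _ _).
- by apply: eq_integral => p; rewrite inE => /itv_1a p1a; rewrite g_right.
- by move=> p _; exact: is_derive_u_right.
- by move=> p _; polynomial_continuity.
- exact: continuous_of_derive (is_derive_u_right 1).
- exact: continuous_of_derive (is_derive_u_right a).
- by move=> p /itv_1a_gt0 p0; rewrite !(mulr_gt0, divr_gt0, invr_gt0, exprn_gt0).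
- move=> u; rewrite in_itv/= => /andP[mu u1]; apply: continuous_g.
  by rewrite u1 andbT (lt_trans _ mu)//; case/andP: midpoint01.
- by move=> u _; rewrite divr_ge0 ?sqr_ge0.
Qed.

Let integral_left :
  (\int[lebesgue_measure]_(u in `]0%R, midpoint[) (g u)%:E =
   \int[lebesgue_measure]_(p in `]1%R, a[)
     (2 * a ^+ 2 * s * p ^- 2 / Num.sqrt (P p))%:E)%E.
Proof.
have := @ge0_substitution_decreasing R u_left
  (fun p => - (2 * a ^+ 2 * p ^- 3 / (a ^+ 4 - 1))) g 1 a a_gt1.
rewrite u_left1 u_lefta => subst; rewrite (subst _ _ _ _ _ _ _).
- by apply: eq_integral => p; rewrite inE => /itv_1a p1a; rewrite opprK g_left.
- by move=> p /itv_1a_gt0; exact: is_derive_u_left.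
- move=> p /itv_1a_gt0 p0; apply: continuous_at_opp; apply: continuous_at_mul; last polynomial_continuity.
  apply: continuous_at_mul; first polynomial_continuity.
  apply: continuous_at_inv; last by rewrite expf_neq0// gt_eqF.
  by polynomial_continuity.
- exact: continuous_of_derive (is_derive_u_left _ ltr01).
- exact: continuous_of_derive (is_derive_u_left _ a0).
- by move=> p /itv_1a_gt0 p0; rewrite oppr_lt0 !(mulr_gt0, divr_gt0, invr_gt0, exprn_gt0).
- move=> u; rewrite in_itv/= => /andP[u0 um]; apply: continuous_g.
  by rewrite u0 (lt_trans um)//; case/andP: midpoint01.
- by move=> u _; rewrite divr_ge0 ?sqr_ge0.
Qed.

Let h_ge0 x : 0 <= h x.
Proof.
rewrite /h divr_ge0 ?sqrtr_ge0// addr_ge0// mulr_ge0 ?sqr_ge0//.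
by rewrite mulr_ge0 ?sqr_ge0.
Qed.

Let h_radicand_gt0 x : 0 < x < 1 -> 0 < (1 - x ^+ 2) * (1 - k ^+ 2 * x ^+ 2).
Proof.
move=> /andP[x0 x1']; have /andP[k0 k1] := k01.
have x21 : x ^+ 2 < 1 by rewrite expr_lt1// ltW.
have kx1 : k * x < 1 by rewrite mulr_ilt1// ltW.
by rewrite mulr_gt0 ?subr_gt0// -exprMn expr_lt1// mulr_ge0// ltW.
Qed.

Let continuous_h x : x \in `]0, 1[ -> {for x, continuous h}.
Proof.
rewrite in_itv/= => x01; apply: (@continuous_div_sqrt _
  (fun x => 1 + ((b ^+ 2 - 1) / b) ^+ 2 * (k ^+ 2 * x ^+ 2))
  (fun x => (1 - x ^+ 2) * (1 - k ^+ 2 * x ^+ 2))).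
- by polynomial_continuity.
- by polynomial_continuity.
- exact: h_radicand_gt0.
Qed.

Let integral_h :
  (\int[lebesgue_measure]_(x in `]0%R, 1%R[) (h x)%:E =
   \int[lebesgue_measure]_(p in `]1%R, a[)
     (a * (b ^+ 2 - 1) * (p ^+ 4 + p ^- 2) / Num.sqrt (P p))%:E)%E.
Proof.
have := @ge0_substitution_increasing R x_of
  (fun p => (1 + p ^- 2) * (a / (a ^+ 2 - 1))) h 1 a a_gt1.
rewrite x_of1 x_ofa => subst; rewrite (subst _ _ _ _ _ _ _).
- by apply: eq_integral => p; rewrite inE => /itv_1a p1a; rewrite h_x_of.
- by move=> p /itv_1a_gt0; exact: is_derive_x_of.
- move=> p /itv_1a_gt0 p0; apply: continuous_at_mul; last polynomial_continuity.
  apply: continuous_at_add; first polynomial_continuity.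
  apply: continuous_at_inv; last by rewrite expf_neq0// gt_eqF.
  by polynomial_continuity.
- exact: continuous_of_derive (is_derive_x_of _ ltr01).
- exact: continuous_of_derive (is_derive_x_of _ a0).
- by move=> p /itv_1a_gt0 p0; rewrite mulr_gt0 ?divr_gt0// addr_gt0// invr_gt0 exprn_gt0.
- by move=> x; exact: continuous_h.
- by move=> x _; exact: h_ge0.
Qed.

(** The two halves of the integral and the pullback of [h] are all written over
    [1 < p < a], where the sum of the halves is a constant multiple of that
    pullback. *)
Let integral_g :
  (\int[lebesgue_measure]_(u in `]0%R, 1%R[) (g u)%:E =
   (2 * a * s / (b ^+ 2 - 1))%:E *
   \int[lebesgue_measure]_(x in `]0%R, 1%R[) (h x)%:E)%E.
Proof.
have /andP[m0 m1] := midpoint01.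
have measurable_quotient (n : R -> R) : {in `]1, a[, continuous n} ->
    measurable_fun (`]1, a[%classic : set R) (fun p => n p / Num.sqrt (P p)).
  move=> cn; apply: continuous_in_measurable => // p; rewrite inE => p1a.
  apply: (@continuous_div_sqrt _ n P); first exact: cn.
    by rewrite /P; polynomial_continuity.
  by rewrite P_gt0// itv_1a.
have cinv2 : {in `]1, a[, continuous (fun p : R => p ^- 2)}.
  move=> p /itv_1a_gt0 p0; apply: continuous_at_inv; last by rewrite expf_neq0// gt_eqF.
  by polynomial_continuity.
transitivity (\int[lebesgue_measure]_(u in `]0%R, midpoint[) (g u)%:E +
              \int[lebesgue_measure]_(u in `]midpoint, 1%R[) (g u)%:E)%E.
  have mg : measurable_fun (`]0, 1[%classic : set R) g.
    apply: continuous_in_measurable => // u; rewrite inE/= in_itv/=.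
    exact: continuous_g.
  have split01 : (`]0, 1[%classic : set R) = `]0, midpoint[ `|` `[midpoint, 1[.
    by rewrite -itv_bndbnd_setU// bnd_simp ltW.
  rewrite split01 ge0_integral_setU//=; last 3 first.
  - by rewrite -split01; apply/measurable_EFinP.
  - by move=> u _; rewrite lee_fin divr_ge0 ?sqr_ge0.
  - apply/disj_setPS => u [/=]; rewrite !in_itv/= => /andP[_ um] /andP[mu _].
    by rewrite ltNge mu in um.
  congr (_ + _)%E; apply: integral_itv_bndoo.
  apply/measurable_EFinP; apply: measurable_funS mg => //.
  by apply: subset_itvr; rewrite bnd_simp ltW.
rewrite integral_left integral_right integral_h.
have Ps p : p \in `]1, a[ -> 0 < Num.sqrt (P p).
  by move=> /itv_1a p1a; rewrite sqrtr_gt0 P_gt0.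
have c0 : 0 <= 2 * a ^+ 2 * s by rewrite mulr_ge0 ?(ltW s0)// mulr_ge0 ?sqr_ge0.
have d0 : 0 <= a * (b ^+ 2 - 1) by rewrite ltW// mulr_gt0.
rewrite -ge0_integralD//; last first.
- apply/measurable_EFinP; apply: (measurable_quotient (fun p => 2 * a ^+ 2 * s * p ^+ 4)).
  by move=> p _; polynomial_continuity.
- by move=> p _; rewrite lee_fin divr_ge0// mulr_ge0// exprn_even_ge0.
- apply/measurable_EFinP; apply: (measurable_quotient (fun p => 2 * a ^+ 2 * s * p ^- 2)).
  by move=> p p1a; apply: continuous_at_mul; [polynomial_continuity|exact: cinv2].
- by move=> p _; rewrite lee_fin divr_ge0// mulr_ge0// invr_ge0 sqr_ge0.
rewrite -ge0_integralZl//; last first.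
- by rewrite lee_fin divr_ge0 ?mulr_ge0 ?(ltW a0) ?(ltW s0) ?(ltW b2_gt1).
- by move=> p _; rewrite lee_fin divr_ge0// mulr_ge0// addr_ge0 ?invr_ge0 ?exprn_even_ge0.
- apply/measurable_EFinP.
  apply: (measurable_quotient (fun p => a * (b ^+ 2 - 1) * (p ^+ 4 + p ^- 2))).
  move=> p p1a; apply: continuous_at_mul; first by polynomial_continuity.
  by apply: continuous_at_add; [polynomial_continuity|exact: cinv2].
apply: eq_integral => p; rewrite inE => p1a; have p0 := itv_1a_gt0 _ p1a; have Pp := Ps _ p1a.
rewrite -EFinD -EFinM; congr EFin; field.
by rewrite !denominators !gt_eqF.
Qed.

Let integral_g_elliptic :
  \int[lebesgue_measure]_(u in `]0, 1[) g u =
  2 * a * s / (b ^+ 2 - 1) / b ^+ 2 *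
  ((1 - b ^+ 2 + b ^+ 4) * ellipticK k - (b ^+ 2 - 1) ^+ 2 * ellipticE k).
Proof.
rewrite /Rintegral integral_g elliptic_combination//= -/k.
by field; rewrite !denominators.
Qed.

(** It is [b^2] times the integral of [h], and [h >= 1] on the open unit interval. *)
Lemma elliptic_numerator_gt0 :
  0 < (1 - b ^+ 2 + b ^+ 4) * ellipticK k - (b ^+ 2 - 1) ^+ 2 * ellipticE k.
Proof.
have b20 : 0 < b ^+ 2 by rewrite exprn_gt0.
have := elliptic_combination k k01 (((b ^+ 2 - 1) / b) ^+ 2).
set J := (X in _ = X%:E) => JE.
have -> : (1 - b ^+ 2 + b ^+ 4) * ellipticK k - (b ^+ 2 - 1) ^+ 2 * ellipticE k = b ^+ 2 * J.
  by rewrite /J; field; rewrite !denominators.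
rewrite mulr_gt0// (lt_le_trans ltr01)// -lee_fin -JE.
have -> : (1 : R)%:E = (\int[lebesgue_measure]_(x in `](0 : R)%R, (1 : R)%R[) 1%:E)%E.
  by rewrite integral_cst//= lebesgue_measure_itv/= lte_fin ltr01 oppr0 adde0 mule1.
apply: ge0_le_integral => //.
- apply/measurable_EFinP; apply: continuous_in_measurable => // x; rewrite inE.
  exact: continuous_h.
- move=> x; rewrite /= in_itv/= => x01; rewrite lee_fin.
  have d0 := h_radicand_gt0 _ x01.
  rewrite ler_pdivlMr ?sqrtr_gt0// mul1r.
  apply: (@le_trans _ _ 1); last by rewrite lerDl mulr_ge0 ?sqr_ge0// mulr_ge0 ?sqr_ge0.
  have /andP[x0' x1'] := x01; have x21 : x ^+ 2 <= 1 by rewrite exprn_ile1// ltW.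
  have k2x2 : 0 < 1 - k ^+ 2 * x ^+ 2.
    by rewrite -(pmulr_rgt0 _ (_ : 0 < 1 - x ^+ 2))// subr_gt0 expr_lt1// ltW.
  have kx0 : 0 <= k ^+ 2 * x ^+ 2 by rewrite -exprMn sqr_ge0.
  rewrite -[leRHS]sqrtr1 ler_sqrt// mulr_ile1 ?subr_ge0 ?gerBl ?sqr_ge0//.
  by rewrite -subr_ge0 ltW.
Qed.

Let lauricella_integrandE (u : R) : u \in `]0, 1[ ->
  u `^ (1 / 2 - 1) * (1 - u) `^ (1 - 1 / 2 - 1)
  / \prod_(j < 3) (1 - tnth [tuple x1; x2; x3] j * u)
      `^ (tnth [tuple - (3 / 2); 1 / 2; 1 / 2] j) = g u.
Proof.
rewrite in_itv/= => u01; have [l1 l2 l3] := x_lt1.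
have u01' : 0 <= u <= 1 by have /andP[/ltW-> /ltW->] := u01.
have p1 := factor_gt0 _ _ l1 u01'; have p2 := factor_gt0 _ _ l2 u01'.
have p3 := factor_gt0 _ _ l3 u01'.
have p0 : 0 < u * (1 - u) by have /andP[u0 u1] := u01; rewrite mulr_gt0// subr_gt0.
rewrite -/(arcsine_weight u) arcsine_weightE//.
rewrite 3!big_ord_recl big_ord0 !(tnth_nth 0)/= mulr1 /g /D.
move: (u * (1 - u)) (1 - x1 * u) (1 - x2 * u) (1 - x3 * u) p0 p1 p2 p3.
move=> q0 q1 q2 q3 p0 p1 p2 p3.
rewrite !sqrtrM ?mulr_ge0 ?(ltW p0) ?(ltW p1) ?(ltW p2)//.
rewrite div1r !powR12_sqrt ?(ltW p2) ?(ltW p3)//.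
have -> : - (3 / 2) = 2^-1 - 2%:R :> R by field.
rewrite powRB; last by rewrite (gt_eqF p1) implybT.
rewrite powR12_sqrt ?(ltW p1)// powR_mulrn ?(ltW p1)//.
by field; rewrite !gt_eqF ?sqrtr_gt0.
Qed.

Lemma lauricellaFD_elliptic :
  lauricellaFD (1 / 2) [tuple - (3 / 2); 1 / 2; 1 / 2] 1 [tuple x1; x2; x3] =
  pi^-1 * (2 * a * s / (b ^+ 2 - 1) / b ^+ 2 *
  ((1 - b ^+ 2 + b ^+ 4) * ellipticK k - (b ^+ 2 - 1) ^+ 2 * ellipticE k)).
Proof.
rewrite lauricellaFD_half_one -integral_g_elliptic; congr (_ * fine _).
have mg : measurable_fun (`]0, 1[%classic : set R) g.
  apply: continuous_in_measurable => // u; rewrite inE/= in_itv/=.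
  exact: continuous_g.
rewrite -(@integral_itv_bndoo _ 0 1 (EFin \o g) true false); last exact/measurable_EFinP.
apply: eq_integral_itv_bounded => //.
by apply: eq_measurable_fun mg => u; rewrite inE => /lauricella_integrandE.
Qed.

End reduction.

Theorem theorem5p5 (R : realType) (a b : R) (h1a : 1 < a) (hab : a < b) :
  pi =
    (2 * a * Num.sqrt (b ^+ 2 - a ^+ 2) * Num.sqrt (a ^+ 2 * b ^+ 2 - 1))
      / (b ^+ 2 * (b ^+ 2 - 1))
    * (((1 - b ^+ 2 + b ^+ 4)
          * ellipticK ((b * (a ^+ 2 - 1)) / (a * (b ^+ 2 - 1)))
        - (b ^+ 2 - 1) ^+ 2
          * ellipticE ((b * (a ^+ 2 - 1)) / (a * (b ^+ 2 - 1))))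
       / lauricellaFD (1 / 2) [tuple - (3 / 2); 1 / 2; 1 / 2] 1
           [tuple 1 - a ^+ 4;
                  ((a ^+ 4 - 1) * b ^+ 2) / (a ^+ 2 - b ^+ 2);
                  (a ^+ 4 - 1) / (a ^+ 2 * b ^+ 2 - 1)]).
Proof.
have a0 : 0 < a := lt_trans ltr01 h1a.
have b1 : 1 < b := lt_trans h1a hab.
have b0 : 0 < b := lt_trans ltr01 b1.
have b21 : 0 < b ^+ 2 - 1 by rewrite subr_gt0 expr_gt1// ltW.
have s1 : 0 < Num.sqrt (b ^+ 2 - a ^+ 2).
  by rewrite sqrtr_gt0 subr_gt0 ltr_pXn2r// nnegrE ltW.
have s2 : 0 < Num.sqrt (a ^+ 2 * b ^+ 2 - 1).
  by rewrite sqrtr_gt0 -exprMn subr_gt0 expr_gt1 ?mulr_ge0 ?ltW// mulr_egt1.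
have := elliptic_numerator_gt0 a b h1a hab; rewrite lauricellaFD_elliptic//.
move: (_ - _ * ellipticE _) => N N0.
move: pi (@pi_gt0 R) => p p0; field.
by rewrite !gt_eqF.
Qed.
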